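(* Let $S\subset\mathbb{R}^3$ be a translation surface in Euclidean space, i.e. a surface admitting a parametrization $X(s,t)=\alpha(s)+\beta(t)$, $s\in I$, $t\in J$, where $\alpha:I\subset\mathbb{R}\to\mathbb{R}^3$ and $\beta:J\subset\mathbb{R}\to\mathbb{R}^3$ are smooth curves (the generating curves). (1) If $S$ has constant Gauss curvature $K=0$, then $S$ is a cylindrical surface. (2) If one of the generating curves $\alpha$ or $\beta$ is planar (contained in a plane), then $S$ does not have constant Gauss curvature $K\neq 0$; that is, there is no translation surface with constant nonzero Gauss curvature having a planar generating curve.
   Context: Euclidean space $\mathbb{R}^3$ with its standard metric. A cylindrical surface is a ruled surface whose rulings are all parallel to a fixed direction. *)

(* Defs.v *)
From Stdlib Require Import Reals.
From Coquelicot Require Import Coquelicot.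
Open Scope R_scope.

Definition vec := (R * R * R)%type.
Definition vx (u : vec) : R := fst (fst u).
Definition vy (u : vec) : R := snd (fst u).
Definition vz (u : vec) : R := snd u.
Definition mkv (a b c : R) : vec := (a, b, c).
Definition vadd (u w : vec) : vec := mkv (vx u + vx w) (vy u + vy w) (vz u + vz w).
Definition vsub (u w : vec) : vec := mkv (vx u - vx w) (vy u - vy w) (vz u - vz w).
Definition vscal (l : R) (u : vec) : vec := mkv (l * vx u) (l * vy u) (l * vz u).
Definition vdot (u w : vec) : R := vx u * vx w + vy u * vy w + vz u * vz w.
Definition vcross (u w : vec) : vec :=
  mkv (vy u * vz w - vz u * vy w) (vz u * vx w - vx u * vz w) (vx u * vy w - vy u * vx w).
Definition vnorm (u : vec) : R := sqrt (vdot u u).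
Definition vzero : vec := mkv 0 0 0.

Definition in_interval (a b : Rbar) (x : R) : Prop := Rbar_lt a x /\ Rbar_lt x b.

Definition smooth_on (D : R -> Prop) (f : R -> R) : Prop :=
  forall (k : nat) (x : R), D x -> ex_derive (Derive_n f k) x.

Definition smooth_curve_on (D : R -> Prop) (c : R -> vec) : Prop :=
  smooth_on D (fun s => vx (c s)) /\ smooth_on D (fun s => vy (c s)) /\
  smooth_on D (fun s => vz (c s)).

Definition vderive (c : R -> vec) (s : R) : vec :=
  mkv (Derive (fun u => vx (c u)) s) (Derive (fun u => vy (c u)) s)
      (Derive (fun u => vz (c u)) s).

Definition X_s (X : R -> R -> vec) (s t : R) : vec := vderive (fun u => X u t) s.
Definition X_t (X : R -> R -> vec) (s t : R) : vec := vderive (fun u => X s u) t.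

Definition regular_on (D1 D2 : R -> Prop) (X : R -> R -> vec) : Prop :=
  forall s t, D1 s -> D2 t -> vcross (X_s X s t) (X_t X s t) <> vzero.

Definition gauss_curvature (X : R -> R -> vec) (s t : R) : R :=
  let Xs := X_s X s t in
  let Xt := X_t X s t in
  let Xss := vderive (fun u => X_s X u t) s in
  let Xst := vderive (fun u => X_s X s u) t in
  let Xtt := vderive (fun u => X_t X s u) t in
  let nrm := vscal (/ vnorm (vcross Xs Xt)) (vcross Xs Xt) in
  let E := vdot Xs Xs in
  let F := vdot Xs Xt in
  let G := vdot Xt Xt in
  let L := vdot Xss nrm in
  let M := vdot Xst nrm in
  let N := vdot Xtt nrm in
  (L * N - M * M) / (E * G - F * F).

Definition translation_param (alpha beta : R -> vec) : R -> R -> vec :=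
  fun s t => vadd (alpha s) (beta t).

Definition trace (D1 D2 : R -> Prop) (X : R -> R -> vec) (p : vec) : Prop :=
  exists s t, D1 s /\ D2 t /\ X s t = p.

(** A set S of R^3 is a cylindrical surface: it is ruled, with all rulings
    parallel to a fixed nonzero direction v, i.e. through every point p of S
    passes a (nondegenerate) line segment of direction v contained in S. *)
Definition cylindrical (S : vec -> Prop) : Prop :=
  exists v : vec, v <> vzero /\
    forall p, S p -> exists eps, 0 < eps /\
      forall l, Rabs l < eps -> S (vadd p (vscal l v)).

Definition planar_on (D : R -> Prop) (c : R -> vec) : Prop :=
  exists (p nv : vec), nv <> vzero /\ forall s, D s -> vdot (vsub (c s) p) nv = 0.

(* Main.v *)
(** Write [N = alpha' x beta'], [a = alpha' x alpha''], [b = beta' x beta'']; since the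
    mixed derivative vanishes, [K |N|^4 = - (a . beta') (b . alpha')].

    If [K = 0], both factors vanish at every [(s, t)] with [a s <> 0] and [b t <> 0]
    (otherwise differentiating the other factor gives [a || b]), so there [a], [b] and [N]
    are parallel.  As the direction of [alpha'] keeps a constant angle with any vector
    parallel to all [a s], both curves lie in parallel planes and the surface is open in a
    plane, unless [a = 0] or [b = 0] throughout, in which case one of the curves is straight.

    If [alpha] is planar with unit normal [n] and [K = c <> 0], let [T] be the unit tangent of
    [alpha], [B = beta' / (beta' . n)], [u = (T x n) . B] and [w = T . B].  In terms of the
    angle [theta] of [T], [u_theta = w] and [w_theta = - u], and the curvature equation
    separates as [u_t = mu(s) z(t) (1 + u^2)^2].  Two differentiations in [theta] turn this
    into a quadratic equation for [w] over the functions of [u], with coefficients constant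
    in [t]; together with its [t]-derivative it makes [w] rational in [u], which is
    incompatible with the differential equation of [w]. *)
Require Import Defs.
From Stdlib Require Import Reals Lra Ranalysis5 Classical ClassicalEpsilon.
From Coquelicot Require Import Coquelicot.
Open Scope R_scope.

(** * Calculus on open intervals *)

Lemma in_interval_locally (a b : Rbar) (x : R) :
  in_interval a b x -> locally x (in_interval a b).
Proof.
  intros Hx.
  exact (open_and _ _ (open_Rbar_gt a) (open_Rbar_lt b) x Hx).
Qed.

Lemma in_interval_inhabited (a b : Rbar) : Rbar_lt a b -> exists x, in_interval a b x.
Proof.
  intros H; unfold in_interval.
  destruct a as [a| |], b as [b| |]; simpl in *; try easy.
  - exists ((a + b) / 2); simpl; lra.
  - exists (a + 1); simpl; split; [lra|easy].
  - exists (b - 1); simpl; split; [easy|lra].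
  - exists 0; easy.
Qed.

Lemma in_interval_between (a b : Rbar) (x y z : R) :
  in_interval a b x -> in_interval a b y -> Rmin x y <= z <= Rmax x y ->
  in_interval a b z.
Proof.
  unfold in_interval; intros [Hx1 Hx2] [Hy1 Hy2] Hz.
  revert Hz; apply Rmin_case; apply Rmax_case;
    destruct a, b; simpl in *; intros; split; try easy; lra.
Qed.

Lemma locally_Rabs (P : R -> Prop) (x : R) :
  locally x P <-> exists d, 0 < d /\ forall y, Rabs (y - x) < d -> P y.
Proof.
  split.
  - intros [d Hd]; exists d; split; [apply cond_pos|exact Hd].
  - intros [d [Hd H]]; exists (mkposreal d Hd); exact H.
Qed.

Lemma is_derive_eq (f : R -> R) (x l l' : R) :
  is_derive f x l -> l = l' -> is_derive f x l'.
Proof. now intros H <-. Qed.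

Lemma is_derive_continuous (f : R -> R) (x l : R) : is_derive f x l -> continuous f x.
Proof. intros H; apply (ex_derive_continuous f); now exists l. Qed.

Lemma is_derive_Derive (f : R -> R) (x l : R) : is_derive f x l -> Derive f x = l.
Proof. exact (is_derive_unique f x l). Qed.

Lemma is_derive_R_unique (f : R -> R) (x l l' : R) :
  is_derive f x l -> is_derive f x l' -> l = l'.
Proof. intros H H'. now rewrite <- (is_derive_unique f x l H); apply is_derive_unique. Qed.

Lemma derive_0_const (a b : Rbar) (f : R -> R) :
  (forall x, in_interval a b x -> is_derive f x 0) ->
  forall x y, in_interval a b x -> in_interval a b y -> f x = f y.
Proof.
  intros H x y Hx Hy.
  destruct (MVT_gen f x y (fun _ => 0)) as [c [_ Hc]].
  - intros z Hz; apply H, (in_interval_between a b x y); try easy; lra.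
  - intros z Hz; apply continuity_pt_filterlim, (is_derive_continuous _ _ 0), H.
    now apply (in_interval_between a b x y).
  - lra.
Qed.

(** The tool for differentiating an identity that holds throughout an open interval: the two sides
    agree near [x], and derivatives are local. *)
Lemma derive_eq_on (a b : Rbar) (f g : R -> R) (x df dg : R) :
  in_interval a b x ->
  (forall y, in_interval a b y -> f y = g y) ->
  is_derive f x df -> is_derive g x dg -> df = dg.
Proof.
  intros Hx He Hf Hg.
  apply (is_derive_R_unique g x); [|exact Hg].
  apply (is_derive_ext_loc f); [|exact Hf].
  generalize (in_interval_locally a b x Hx); apply filter_imp; exact He.
Qed.

(** Near [x0] the derivative stays positive, so [f] is strictly increasing on a closed interval and
    the intermediate value theorem makes it onto the interval between the end values. The inverse is
    continuous near [f x0]; its derivative is recorded at [f x0] alone, which suffices for moving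
    along a segment from a given point. *)
Lemma local_inverse_pos (f df : R -> R) (x0 d : R) :
  0 < d -> (forall x, Rabs (x - x0) < d -> is_derive f x (df x)) ->
  continuous df x0 -> 0 < df x0 ->
  exists (g : R -> R) (e : R), 0 < e /\ g (f x0) = x0 /\
    is_derive g (f x0) (/ df x0) /\
    forall y, Rabs (y - f x0) < e ->
      Rabs (g y - x0) < d /\ f (g y) = y /\ continuous g y.
Proof.
  intros Hd Hf Hc Hp.
  destruct (proj1 (locally_Rabs (fun x => 0 < df x) x0)) as [d1 [Hd1 H1]].
  { apply (Hc (fun y => 0 < y)). now apply open_gt. }
  set (h := Rmin d d1 / 2).
  assert (Hh : 0 < h /\ h < d /\ h < d1).
  { unfold h; generalize (Rmin_l d d1) (Rmin_r d d1) (Rmin_pos d d1 Hd Hd1); lra. }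
  set (a := x0 - h). set (b := x0 + h).
  assert (Hin : forall x, a <= x <= b -> is_derive f x (df x) /\ 0 < df x).
  { unfold a, b; intros x Hx. split; [apply Hf|apply H1]; apply Rabs_def1; lra. }
  assert (Hab : a < x0 < b) by (unfold a, b; lra).
  assert (Hinc : forall x y, a <= x -> x < y -> y <= b -> f x < f y).
  { intros x y Hx Hxy Hy.
    apply (incr_function_le f a b df); try easy.
    - intros; now apply Hin.
    - intros; now apply Hin. }
  assert (Hct : forall x, a <= x <= b -> continuity_pt f x).
  { intros x Hx; apply continuity_pt_filterlim, (is_derive_continuous _ _ (df x)), Hin, Hx. }
  assert (Hsurj : forall y, f a <= y <= f b -> exists x, a <= x <= b /\ f x = y).
  { intros y [[Hya|Hya] [Hyb|Hyb]].
    - destruct (IVT_interv (fun x => f x - y) a b) as [x [Hx E]]; try lra.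
      + intros x Hx. apply continuity_pt_minus; [now apply Hct|].
        apply continuity_pt_const; now intros ? ?.
      + exists x; split; [easy|lra].
    - exists b; split; [lra|easy].
    - exists a; split; [lra|easy].
    - exists b; split; [lra|easy]. }
  (* A preimage is chosen inside [[a, b]]; outside [[f a, f b]] the value of [g] is arbitrary. *)
  set (g := fun y => epsilon (inhabits 0) (fun x => a <= x <= b /\ f x = y)).
  assert (Hg : forall y, f a <= y <= f b -> a <= g y <= b /\ f (g y) = y).
  { intros y Hy; exact (epsilon_spec (inhabits 0) _ (Hsurj y Hy)). }
  assert (Hinj : forall x y, a <= x <= b -> a <= y <= b -> f x = f y -> x = y).
  { intros x y Hx Hy E. destruct (Rtotal_order x y) as [L|[L|L]]; [|exact L|].
    - generalize (Hinc x y (proj1 Hx) L (proj2 Hy)); lra.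
    - generalize (Hinc y x (proj1 Hy) L (proj2 Hx)); lra. }
  assert (Ha0 : f a < f x0) by (apply Hinc; lra).
  assert (H0b : f x0 < f b) by (apply Hinc; lra).
  assert (Hg0 : g (f x0) = x0).
  { destruct (Hg (f x0)) as [? ?]; [lra|]. apply Hinj; lra. }
  assert (Hgl : g (f a) = a).
  { destruct (Hg (f a)) as [? ?]; [lra|]. apply Hinj; lra. }
  assert (Hgr : g (f b) = b).
  { destruct (Hg (f b)) as [? ?]; [lra|]. apply Hinj; lra. }
  assert (Hgc : forall y, f a < y < f b -> continuity_pt g y).
  { intros y Hy.
    apply (continuity_pt_recip_interv f g a b); try easy; try lra.
    - intros x L1 L2; unfold comp, id. now apply Hg.
    - intros x L1 L2; now apply Hg. }
  exists g, (Rmin (f x0 - f a) (f b - f x0)).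
  split; [apply Rmin_pos; lra|]. split; [exact Hg0|]. split.
  - apply is_derive_Reals.
    assert (Prf : forall z, g (f a) <= z <= g (f b) -> derivable_pt f z).
    { rewrite Hgl, Hgr. intros z Hz. apply ex_derive_Reals_0. exists (df z). now apply Hin. }
    assert (Hz : g (f a) <= g (f x0) <= g (f b)) by (rewrite Hgl, Hgr, Hg0; lra).
    assert (E : derive_pt f (g (f x0)) (Prf (g (f x0)) Hz) = df x0).
    { rewrite Derive_Reals, Hg0. apply is_derive_unique, Hin; lra. }
    replace (/ df x0) with (1 / derive_pt f (g (f x0)) (Prf (g (f x0)) Hz))
      by (rewrite E; field; lra).
    apply derivable_pt_lim_recip_interv; try lra.
    + apply Hgc; lra.
    + intros y Hy; unfold comp, id; now apply Hg.
  - intros y Hy.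
    assert (Hy' : f a < y < f b).
    { apply Rabs_def2 in Hy.
      generalize (Rmin_l (f x0 - f a) (f b - f x0)) (Rmin_r (f x0 - f a) (f b - f x0)); lra. }
    destruct (Hg y) as [G1 G2]; [lra|].
    split; [unfold a, b in G1; apply Rabs_def1; lra|].
    split; [exact G2|]. now apply continuity_pt_filterlim, Hgc.
Qed.

Lemma local_inverse (f df : R -> R) (x0 d : R) :
  0 < d -> (forall x, Rabs (x - x0) < d -> is_derive f x (df x)) ->
  continuous df x0 -> df x0 <> 0 ->
  exists (g : R -> R) (e : R), 0 < e /\ g (f x0) = x0 /\
    is_derive g (f x0) (/ df x0) /\
    forall y, Rabs (y - f x0) < e ->
      Rabs (g y - x0) < d /\ f (g y) = y /\ continuous g y.
Proof.
  intros Hd Hf Hc Hn.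
  destruct (Rtotal_order (df x0) 0) as [L|[L|L]]; [|easy|].
  2: now apply local_inverse_pos.
  destruct (local_inverse_pos (fun x => - f x) (fun x => - df x) x0 d)
    as [g [e [He [G0 [G1 G2]]]]]; try easy.
  - intros x Hx. now apply (is_derive_opp f), Hf.
  - now apply (continuous_opp df).
  - lra.
  - exists (fun y => g (- y)), e. split; [easy|]. split; [easy|]. split.
    + apply (is_derive_eq _ _ ((-1) * / (- df x0))); [|field; lra].
      apply (is_derive_comp g (fun y => - y)); [exact G1|].
      auto_derive; [easy|ring].
    + intros y Hy. destruct (G2 (- y)) as [K1 [K2 K3]].
      { replace (- y - - f x0) with (- (y - f x0)) by ring. now rewrite Rabs_Ropp. }
      split; [easy|]. split; [lra|].
      apply (continuous_comp (fun y => - y) g); [|exact K3].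
      apply (is_derive_continuous _ _ (-1)). auto_derive; [easy|ring].
Qed.

Lemma derive_neq0_values (f : R -> R) (x0 d df : R) :
  0 < d -> (forall x, Rabs (x - x0) < d -> continuous f x) ->
  is_derive f x0 df -> df <> 0 ->
  exists e, 0 < e /\ forall l, Rabs l < e ->
    exists x, Rabs (x - x0) < d /\ f x = f x0 + l.
Proof.
  assert (Pos : forall f df, 0 < d -> (forall x, Rabs (x - x0) < d -> continuous f x) ->
    is_derive f x0 df -> 0 < df ->
    exists e, 0 < e /\ forall l, Rabs l < e ->
      exists x, Rabs (x - x0) < d /\ f x = f x0 + l).
  { clear f df. intros f df Hd Hc Hf Hp.
    (* With [df] itself as tolerance, the difference quotient lies within [df] of [df], hence is
       positive. *)
    apply is_derive_Reals in Hf. destruct (Hf df Hp) as [h0 Hh0].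
    set (h := Rmin d h0 / 2).
    assert (Hh : 0 < h /\ h < d /\ h < h0).
    { unfold h; generalize (Rmin_l d h0) (Rmin_r d h0) (Rmin_pos d h0 Hd (cond_pos h0)); lra. }
    assert (Hr : f x0 < f (x0 + h)).
    { assert (A := Hh0 h). rewrite (Rabs_right h) in A by lra.
      specialize (A ltac:(lra) ltac:(lra)). apply Rabs_def2 in A.
      assert (0 < (f (x0 + h) - f x0) / h) by lra.
      replace (f (x0 + h)) with (f x0 + (f (x0 + h) - f x0) / h * h) by (field; lra). nra. }
    assert (Hl : f (x0 - h) < f x0).
    { assert (A := Hh0 (- h)). rewrite Rabs_Ropp, (Rabs_right h) in A by lra.
      specialize (A ltac:(lra) ltac:(lra)). apply Rabs_def2 in A.
      assert (0 < (f (x0 + - h) - f x0) / - h) by lra.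
      replace (f (x0 - h)) with (f x0 + (f (x0 + - h) - f x0) / - h * - h).
      2: { unfold Rminus; field; lra. } nra. }
    exists (Rmin (f (x0 + h) - f x0) (f x0 - f (x0 - h))).
    split; [apply Rmin_pos; lra|]. intros l L. apply Rabs_def2 in L.
    generalize (Rmin_l (f (x0 + h) - f x0) (f x0 - f (x0 - h)))
      (Rmin_r (f (x0 + h) - f x0) (f x0 - f (x0 - h))); intros M1 M2.
    destruct (IVT_interv (fun x => f x - (f x0 + l)) (x0 - h) (x0 + h)) as [x [Hx E]]; try lra.
    - intros x Hx. apply continuity_pt_minus.
      + apply continuity_pt_filterlim, Hc, Rabs_def1; lra.
      + apply continuity_pt_const; now intros ? ?.
    - exists x; split; [apply Rabs_def1; lra|lra]. }
  intros Hd Hc Hf Hn.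
  destruct (Rtotal_order df 0) as [L|[L|L]]; [|easy|].
  2: now apply (Pos f df).
  destruct (Pos (fun x => - f x) (- df)) as [e [He H]]; try easy; try lra.
  - intros x Hx; now apply (continuous_opp f), Hc.
  - now apply (is_derive_opp f).
  - exists e; split; [easy|]. intros l Hl.
    destruct (H (- l)) as [x [Hx E]]; [now rewrite Rabs_Ropp|].
    exists x; split; [easy|lra].
Qed.

(** * The separated curvature equation *)

(* [u], [w] as in the header, [v], [y] their derivatives in [t], [om] the derivative of the
   angle [theta]. *)
Lemma curvature_system_absurd (a1 b1 a2 b2 : Rbar) (u w v y : R -> R -> R) (om mu z : R -> R) :
  Rbar_lt a1 b1 -> Rbar_lt a2 b2 ->
  (forall s t, in_interval a1 b1 s -> in_interval a2 b2 t ->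
    is_derive (fun s => u s t) s (om s * w s t) /\
    is_derive (fun s => w s t) s (- (om s * u s t)) /\
    is_derive (fun s => v s t) s (om s * y s t) /\
    is_derive (fun s => y s t) s (- (om s * v s t)) /\
    is_derive (u s) t (v s t) /\ is_derive (w s) t (y s t) /\
    v s t = mu s * z t * (1 + u s t ^ 2) ^ 2) ->
  (forall s, in_interval a1 b1 s -> om s <> 0 /\ mu s <> 0) ->
  (forall t, in_interval a2 b2 t -> z t <> 0) ->
  False.
Proof.
  intros HI HJ H Hom Hz.
  destruct (in_interval_inhabited a1 b1 HI) as [s1 Hs1].
  destruct (in_interval_inhabited a2 b2 HJ) as [t0 Ht0].
  assert (D1 : forall s t, 1 + u s t ^ 2 <> 0).
  { intros s t; generalize (pow2_ge_0 (u s t)); lra. }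
  (* The equation at [t0] expresses [mu] through quantities that can be differentiated in [s]. *)
  set (mu1 := fun s => (y s t0 / (1 + u s t0 ^ 2) ^ 2
                - 4 * u s t0 * w s t0 * v s t0 / (1 + u s t0 ^ 2) ^ 3) / z t0).
  (* Derivatives in [s] are kept as [om s] times a factor, so that [mu1] and later [mu2] are the
     first and second derivatives of [mu] in the angle. *)
  assert (Hmu : forall s, in_interval a1 b1 s -> is_derive mu s (om s * mu1 s)).
  { intros s Hs.
    apply (is_derive_ext_loc (fun s => v s t0 / (1 + u s t0 ^ 2) ^ 2 / z t0)).
    { generalize (in_interval_locally _ _ s Hs); apply filter_imp; intros s' Hs'.
      destruct (H s' t0 Hs' Ht0) as (_ & _ & _ & _ & _ & _ & E). rewrite E.
      match goal with |- ?a = ?b => change (@eq R a b) end; field; split; (apply D1 || (apply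
        Hz; assumption)). }
    destruct (H s t0 Hs Ht0) as (E1 & E2 & E3 & E4 & _).
    assert (X1 := is_derive_Derive (fun s : R => u s t0) s _ E1).
    assert (X3 := is_derive_Derive (fun s : R => v s t0) s _ E3).
    auto_derive.
    - repeat split; try (eexists; eassumption).
      generalize (D1 s t0); simpl; intros N; rewrite Rmult_1_r in *; auto using
        Rmult_integral_contrapositive_currified.
    - rewrite X1, X3. unfold mu1. field. split; (apply D1 || (apply Hz; assumption)). }
  assert (Hmu1 : exists mu2, forall s, in_interval a1 b1 s -> is_derive mu1 s (om s * mu2 s)).
  { exists (fun s => Derive mu1 s / om s). intros s Hs.
    apply (is_derive_eq _ _ (Derive mu1 s)).
    2: { field. now apply Hom. }
    apply Derive_correct.
    destruct (H s t0 Hs Ht0) as (E1 & E2 & E3 & E4 & _).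
    unfold mu1. auto_derive. repeat split; try (eexists; eassumption);
    generalize (D1 s t0); simpl; intros N; rewrite Rmult_1_r in *; auto using
      Rmult_integral_contrapositive_currified. }
  destruct Hmu1 as [mu2 Hmu2].
  (* First derivative of the separated equation in the angle. *)
  assert (Ey : forall s t, in_interval a1 b1 s -> in_interval a2 b2 t ->
    y s t = z t * (mu1 s * (1 + u s t ^ 2) ^ 2 + 4 * mu s * u s t * (1 + u s t ^ 2) * w s t)).
  { intros s t Hs Ht.
    destruct (H s t Hs Ht) as (E1 & E2 & E3 & E4 & _).
    apply (Rmult_eq_reg_l (om s)); [|now apply Hom].
    apply (derive_eq_on a1 b1 (fun s => v s t) (fun s => mu s * z t * (1 + u s t ^ 2) ^ 2) s);
      try easy.
    { intros s' Hs'; now apply H. }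
    auto_derive; [repeat split; eexists; [apply (Hmu s Hs)|exact E1]|].
    rewrite (is_derive_Derive (fun s : R => u s t) s _ E1), (is_derive_Derive (fun s : R => mu
      s) s _ (Hmu s Hs)).
    ring. }
  (* Second derivative in the angle. The left side returns to [- v], to which the equation applies
     again, so [z t] cancels and a quadratic relation for [w] remains whose coefficients in [u] and
     [w] depend on [s] only. *)
  assert (Ev : forall s t, in_interval a1 b1 s -> in_interval a2 b2 t ->
    - mu s * (1 + u s t ^ 2) ^ 2 = mu2 s * (1 + u s t ^ 2) ^ 2
      + 8 * mu1 s * u s t * (1 + u s t ^ 2) * w s t
      + 4 * mu s * ((1 + 3 * u s t ^ 2) * w s t ^ 2 - u s t ^ 2 * (1 + u s t ^ 2))).
  { intros s t Hs Ht.
    destruct (H s t Hs Ht) as (E1 & E2 & E3 & E4 & _ & _ & E7).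
    apply (Rmult_eq_reg_l (om s * z t)).
    2: { apply Rmult_integral_contrapositive_currified; [now apply Hom|now apply Hz]. }
    transitivity (- (om s * v s t)).
    { rewrite E7; ring. }
    apply (derive_eq_on a1 b1 (fun s => y s t) (fun s => z t * (mu1 s * (1 + u s t ^ 2) ^ 2 + 4
      * mu s * u s t * (1 + u s t ^ 2) * w s t)) s); try easy.
    { intros s' Hs'; now apply Ey. }
    auto_derive.
    { repeat split; eexists; (exact E1 || exact E2 || exact (Hmu s Hs) || exact (Hmu2 s Hs)). }
    rewrite (is_derive_Derive (fun s : R => u s t) s _ E1), (is_derive_Derive (fun s : R => w s
      t) s _ E2),
     (is_derive_Derive (fun s : R => mu s) s _ (Hmu s Hs)), (is_derive_Derive (fun s : R => mu1
       s) s _ (Hmu2 s Hs)).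
    ring. }
  destruct (Hom s1 Hs1) as [_ Hm].
  (* From here [s = s1] is fixed. Dividing [Ev] by [4 m (1 + U^2)^2] and writing [w = (1 + U^2) r]
     leaves a relation with the two constants [k] and [e]; the [- 1] in [e] comes from
     [U^2 / (1 + U^2) = 1 - 1 / (1 + U^2)]. *)
  set (m := mu s1) in *. set (k := mu1 s1 / m). set (e := (mu2 s1 / m + 1) / 4 - 1).
  set (U := u s1). set (r := fun t => w s1 t / (1 + U t ^ 2)).
  assert (HU : forall t, in_interval a2 b2 t -> is_derive U t (m * z t * (1 + U t ^ 2) ^ 2)).
  { intros t Ht. destruct (H s1 t Hs1 Ht) as (_ & _ & _ & _ & E5 & _ & E7).
    unfold U, m; now rewrite <- E7. }
  assert (Hr : forall t, in_interval a2 b2 t ->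
    is_derive r t (m * z t * (1 + U t ^ 2) * (k + 2 * U t * r t))).
  { intros t Ht. destruct (H s1 t Hs1 Ht) as (_ & _ & _ & _ & _ & E6 & _).
    assert (E := Ey s1 t Hs1 Ht). unfold r.
    assert (X1 := is_derive_Derive (fun t : R => U t) t _ (HU t Ht)).
    assert (X2 := is_derive_Derive (fun t : R => w s1 t) t _ E6).
    auto_derive.
    - repeat split; try (eexists; eassumption); [exists (m * z t * (1 + U t ^ 2) ^ 2); now
      apply HU|].
      generalize (D1 s1 t); unfold U; simpl; auto.
    - rewrite X1, X2, E. fold m. fold (U t). unfold k. field. split; (apply D1 || exact Hm). }
  (* Up to the nonvanishing factor [m z (1 + U^2)], the pair [(U, r)] follows the polynomial field
     [(1 + U^2, k + 2 U r)]. An identity [F (U, r) = 0] therefore yields the vanishing of the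
     derivative [G] of [F] along this field. *)
  assert (Diff : forall (F G : R -> R -> R),
    (forall t, in_interval a2 b2 t -> F (U t) (r t) = 0) ->
    (forall t, in_interval a2 b2 t ->
       is_derive (fun t => F (U t) (r t)) t (m * z t * (1 + U t ^ 2) * G (U t) (r t))) ->
    forall t, in_interval a2 b2 t -> G (U t) (r t) = 0).
  { intros F G HF HG t Ht.
    assert (E : m * z t * (1 + U t ^ 2) * G (U t) (r t) = 0).
    { apply (derive_eq_on a2 b2 (fun t => F (U t) (r t)) (fun _ => 0) t); auto.
      auto_derive; easy. }
    assert (N := D1 s1 t). assert (N' := Hz t Ht). fold (U t) in N.
    destruct (Rmult_integral _ _ E) as [E'|E']; [exfalso|exact E'].
    revert E'; repeat apply Rmult_integral_contrapositive_currified; assumption. }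
  (* Abbreviations that make the coefficients of [E3] linear. *)
  set (g := (k ^ 2 - 3 * e) / 2). set (h := e + 6 - g).
  assert (E1 : forall t, in_interval a2 b2 t ->
    (1 + 3 * U t ^ 2) * r t ^ 2 + 2 * k * U t * r t + e + / (1 + U t ^ 2) = 0).
  { intros t Ht. assert (E := Ev s1 t Hs1 Ht). fold m in E. fold (U t) in E.
    assert (N := D1 s1 t). fold (U t) in N.
    apply (Rmult_eq_reg_l (4 * m * (1 + U t ^ 2) ^ 2)).
    2: { repeat apply Rmult_integral_contrapositive_currified; try exact Hm; try exact N;
      simpl; lra. }
    rewrite Rmult_0_r.
    apply Rminus_diag_eq in E. rewrite <- (Ropp_involutive 0), Ropp_0, <- E.
    unfold r, k, e. field. split; easy. }
  assert (DU : forall t, 1 + U t ^ 2 <> 0) by (intros t; apply D1).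
  clearbody U r k e.
  (* Half the derivative of [E1] along the field. *)
  assert (E2 : forall t, in_interval a2 b2 t ->
    (5 * U t + 9 * U t ^ 3) * r t ^ 2 + (2 * k + 6 * k * U t ^ 2) * r t + k ^ 2 * U t
      - U t / (1 + U t ^ 2) = 0).
  { intros t Ht.
    apply (Rmult_eq_reg_l 2); [|lra]. rewrite Rmult_0_r.
    rewrite <- (Diff (fun u r => (1 + 3 * u ^ 2) * r ^ 2 + 2 * k * u * r + e + / (1 + u ^ 2))
      (fun u r => (1 + u ^ 2) * (6 * u * r ^ 2 + 2 * k * r - 2 * u / (1 + u ^ 2) ^ 2)
        + (k + 2 * u * r) * (2 * (1 + 3 * u ^ 2) * r + 2 * k * u)) E1) with (t := t); [| |exact Ht].
    { field. apply DU. }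
    clear t Ht. intros t Ht.
    assert (X1 := is_derive_Derive (fun t : R => U t) t _ (HU t Ht)).
    assert (X2 := is_derive_Derive (fun t : R => r t) t _ (Hr t Ht)).
    auto_derive.
    { repeat split; try (eexists; (exact (HU t Ht) || exact (Hr t Ht))).
      generalize (DU t); simpl; auto. }
    rewrite X1, X2. field. apply DU. }
  (* The combination of [E1] and [E2] over the polynomials in [U] in which [r ^ 2] cancels. *)
  assert (E3 : forall t, in_interval a2 b2 t ->
    k * (1 + U t ^ 2) ^ 2 * r t = (h - 3) * U t + (h - 3 * g) * U t ^ 3 - 3 * g * U t ^ 5).
  { intros t Ht. apply Rminus_diag_uniq.
    transitivity ((1 + U t ^ 2) * ((1 + 3 * U t ^ 2) * (0 - 3 * U t * 0) / 2 - U t * 0)).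
    2: field.
    rewrite <- (E2 t Ht) at 1. rewrite <- (E1 t Ht). unfold h, g. field. apply DU. }
  (* Derivative of [E3] along [t], with [r] eliminated by [E3] itself. *)
  assert (E4 : forall t, in_interval a2 b2 t ->
    (h - 3 - k ^ 2) + (3 * (h - 3 * g) - 5 * (h - 3) - 2 * k ^ 2) * U t ^ 2
     + (- 3 * h - 6 * g - k ^ 2) * U t ^ 4 + 3 * g * U t ^ 6 = 0).
  { intros t Ht.
    rewrite <- (Diff (fun u r => (h - 3) * u + (h - 3 * g) * u ^ 3 - 3 * g * u ^ 5
        - k * (1 + u ^ 2) ^ 2 * r)
      (fun u r => (1 + u ^ 2) * ((h - 3) + 3 * (h - 3 * g) * u ^ 2 - 15 * g * u ^ 4)
        - k ^ 2 * (1 + u ^ 2) ^ 2 - 6 * u * (k * (1 + u ^ 2) ^ 2 * r))) with (t := t); [| |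
          |exact Ht].
    { rewrite (E3 t Ht). ring. }
    { clear t Ht. intros t Ht. rewrite (E3 t Ht). ring. }
    clear t Ht. intros t Ht.
    assert (X1 := is_derive_Derive (fun t : R => U t) t _ (HU t Ht)).
    assert (X2 := is_derive_Derive (fun t : R => r t) t _ (Hr t Ht)).
    auto_derive.
    { repeat split; try (eexists; (exact (HU t Ht) || exact (Hr t Ht))). }
    rewrite X1, X2. ring. }
  (* The derivative of [U] never vanishes, so a polynomial identity in [U] may be differentiated
     formally in [U]. Six derivatives evaluated at [t0] form a triangular system for the
     coefficients. The term [0 * U t ^ 6] keeps the shape of the hypothesis, so that [Step] can be
     iterated. *)
  assert (Poly : forall p0 p1 p2 p3 p4 p5 p6,
    (forall t, in_interval a2 b2 t -> p0 + p1 * U t + p2 * U t ^ 2 + p3 * U t ^ 3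
      + p4 * U t ^ 4 + p5 * U t ^ 5 + p6 * U t ^ 6 = 0) ->
    p6 = 0 /\ p4 = 0 /\ p0 = 0).
  { assert (Step : forall p0 p1 p2 p3 p4 p5 p6,
      (forall t, in_interval a2 b2 t -> p0 + p1 * U t + p2 * U t ^ 2 + p3 * U t ^ 3
        + p4 * U t ^ 4 + p5 * U t ^ 5 + p6 * U t ^ 6 = 0) ->
      forall t, in_interval a2 b2 t -> p1 + 2 * p2 * U t + 3 * p3 * U t ^ 2
        + 4 * p4 * U t ^ 3 + 5 * p5 * U t ^ 4 + 6 * p6 * U t ^ 5 + 0 * U t ^ 6 = 0).
    { intros p0 p1 p2 p3 p4 p5 p6 HP t Ht.
      apply (Rmult_eq_reg_l (1 + U t ^ 2)); [|apply DU]. rewrite Rmult_0_r.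
      transitivity ((fun u _ => (1 + u ^ 2) * (p1 + 2 * p2 * u + 3 * p3 * u ^ 2 + 4 * p4 * u ^ 3
          + 5 * p5 * u ^ 4 + 6 * p6 * u ^ 5)) (U t) (r t)); [cbv beta; ring|].
      revert t Ht. apply (Diff (fun u _ => p0 + p1 * u + p2 * u ^ 2 + p3 * u ^ 3 + p4 * u ^ 4
          + p5 * u ^ 5 + p6 * u ^ 6)
        (fun u _ => (1 + u ^ 2) * (p1 + 2 * p2 * u + 3 * p3 * u ^ 2 + 4 * p4 * u ^ 3
          + 5 * p5 * u ^ 4 + 6 * p6 * u ^ 5)) HP).
      intros t Ht.
      assert (X1 := is_derive_Derive (fun t : R => U t) t _ (HU t Ht)).
      auto_derive.
      { repeat split; eexists; apply (HU t Ht). }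
      rewrite X1. ring. }
    intros p0 p1 p2 p3 p4 p5 p6 HP.
    assert (S1 := Step _ _ _ _ _ _ _ HP). assert (S2 := Step _ _ _ _ _ _ _ S1).
    assert (S3 := Step _ _ _ _ _ _ _ S2). assert (S4 := Step _ _ _ _ _ _ _ S3).
    assert (S5 := Step _ _ _ _ _ _ _ S4). assert (S6 := Step _ _ _ _ _ _ _ S5).
    specialize (HP t0 Ht0). specialize (S1 t0 Ht0). specialize (S2 t0 Ht0).
    specialize (S3 t0 Ht0). specialize (S4 t0 Ht0). specialize (S5 t0 Ht0).
    specialize (S6 t0 Ht0).
    assert (Z6 : p6 = 0) by lra. subst p6.
    assert (Z5 : p5 = 0) by lra. subst p5.
    assert (Z4 : p4 = 0) by lra. subst p4.
    assert (Z3 : p3 = 0) by lra. subst p3.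
    assert (Z2 : p2 = 0) by lra. subst p2.
    assert (Z1 : p1 = 0) by lra. subst p1.
    repeat split; lra. }
  destruct (Poly (h - 3 - k ^ 2) 0 (3 * (h - 3 * g) - 5 * (h - 3) - 2 * k ^ 2) 0
    (- 3 * h - 6 * g - k ^ 2) 0 (3 * g)) as (Q6 & Q4 & Q0).
  { intros t Ht. generalize (E4 t Ht). lra. }
  (* The coefficients give [g = 0], [3 h = - k^2] and [h = 3 + k^2], so [h] would be both
     nonpositive and at least 3. *)
  generalize (pow2_ge_0 k). lra.
Qed.

(** * Curves in space *)

Ltac vunfold := unfold vsub, vadd, vscal, vdot, vcross, vzero, mkv, vx, vy, vz in *; simpl fst
  in *; simpl snd in *.

Lemma vec_eq (u w : vec) : vx u = vx w -> vy u = vy w -> vz u = vz w -> u = w.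
Proof.
  destruct u as [[? ?] ?], w as [[? ?] ?]; unfold vx, vy, vz; simpl; now intros -> -> ->.
Qed.

Lemma vdot_pos (u : vec) : u <> vzero -> 0 < vdot u u.
Proof.
  intros H. destruct (Rlt_or_le 0 (vdot u u)) as [L|L]; [exact L|exfalso; apply H].
  destruct u as [[x y] z]; vunfold. apply vec_eq; unfold vx, vy, vz; simpl; nra.
Qed.

Lemma vcross_anticomm (u w : vec) : vcross u w = vscal (-1) (vcross w u).
Proof. apply vec_eq; vunfold; ring. Qed.

(** * Differentiation of vector-valued functions *)

Definition vis_derive (c : R -> vec) (s : R) (d : vec) : Prop :=
  is_derive (fun u => vx (c u)) s (vx d) /\ is_derive (fun u => vy (c u)) s (vy d) /\
  is_derive (fun u => vz (c u)) s (vz d).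

Lemma vis_derive_eq (c : R -> vec) (s : R) (d d' : vec) :
  vis_derive c s d -> d = d' -> vis_derive c s d'.
Proof. now intros H <-. Qed.

Lemma vis_derive_vscal (f : R -> R) (c : R -> vec) (s df : R) (d : vec) :
  is_derive f s df -> vis_derive c s d ->
  vis_derive (fun u => vscal (f u) (c u)) s (vadd (vscal df (c s)) (vscal (f s) d)).
Proof.
  intros Hf (Hx & Hy & Hz).
  split; [|split].
  - exact (is_derive_mult f (fun u => vx (c u)) s _ _ Hf Hx Rmult_comm).
  - exact (is_derive_mult f (fun u => vy (c u)) s _ _ Hf Hy Rmult_comm).
  - exact (is_derive_mult f (fun u => vz (c u)) s _ _ Hf Hz Rmult_comm).
Qed.

Lemma vis_derive_vdot (c e : R -> vec) (s : R) (d d' : vec) :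
  vis_derive c s d -> vis_derive e s d' ->
  is_derive (fun u => vdot (c u) (e u)) s (vdot d (e s) + vdot (c s) d').
Proof.
  intros (Hx & Hy & Hz) (Hx' & Hy' & Hz').
  assert (M := fun f g df dg (Hf : is_derive f s df) (Hg : is_derive g s dg) =>
    is_derive_mult f g s df dg Hf Hg Rmult_comm).
  assert (P := is_derive_plus _ _ s _ _ (is_derive_plus _ _ s _ _ (M _ _ _ _ Hx Hx')
    (M _ _ _ _ Hy Hy')) (M _ _ _ _ Hz Hz')).
  apply (is_derive_eq _ _ _ _ P).
  unfold plus, mult; simpl. unfold vdot. ring.
Qed.

Lemma vis_derive_const (k : vec) (s : R) : vis_derive (fun _ => k) s vzero.
Proof. split; [|split]; apply (is_derive_const (V := R_NormedModule)). Qed.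

Lemma vis_derive_vdot_l (c : R -> vec) (s : R) (d k : vec) :
  vis_derive c s d -> is_derive (fun u => vdot (c u) k) s (vdot d k).
Proof.
  intros H. apply (is_derive_eq _ _ _ _ (vis_derive_vdot _ _ _ _ _ H (vis_derive_const k s))).
  vunfold; ring.
Qed.

Lemma vis_derive_vdot_r (c : R -> vec) (s : R) (d k : vec) :
  vis_derive c s d -> is_derive (fun u => vdot k (c u)) s (vdot k d).
Proof.
  intros H. apply (is_derive_eq _ _ _ _ (vis_derive_vdot _ _ _ _ _ (vis_derive_const k s) H)).
  vunfold; ring.
Qed.

Lemma vis_derive_vcross (c e : R -> vec) (s : R) (d d' : vec) :
  vis_derive c s d -> vis_derive e s d' ->
  vis_derive (fun u => vcross (c u) (e u)) s (vadd (vcross d (e s)) (vcross (c s) d')).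
Proof.
  intros (Hx & Hy & Hz) (Hx' & Hy' & Hz').
  assert (M := fun f g h k df dg dh dk (Hf : is_derive f s df) (Hg : is_derive g s dg)
      (Hh : is_derive h s dh) (Hk : is_derive k s dk) =>
    is_derive_minus _ _ s _ _ (is_derive_mult f g s df dg Hf Hg Rmult_comm)
      (is_derive_mult h k s dh dk Hh Hk Rmult_comm)).
  split; [|split].
  - apply (is_derive_eq _ _ _ _ (M _ _ _ _ _ _ _ _ Hy Hz' Hz Hy')).
    unfold minus, plus, mult, opp; simpl; vunfold; ring.
  - apply (is_derive_eq _ _ _ _ (M _ _ _ _ _ _ _ _ Hz Hx' Hx Hz')).
    unfold minus, plus, mult, opp; simpl; vunfold; ring.
  - apply (is_derive_eq _ _ _ _ (M _ _ _ _ _ _ _ _ Hx Hy' Hy Hx')).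
    unfold minus, plus, mult, opp; simpl; vunfold; ring.
Qed.

Lemma smooth_on_Derive (D : R -> Prop) (f : R -> R) : smooth_on D f -> smooth_on D (Derive f).
Proof.
  intros H k x Hx. apply (ex_derive_ext (Derive_n f (S k))); [|exact (H (S k) x Hx)].
  intros y. rewrite (Derive_n_comp f k 1). now rewrite Nat.add_1_r.
Qed.

Lemma smooth_curve_vderive (D : R -> Prop) (c : R -> vec) :
  smooth_curve_on D c -> smooth_curve_on D (vderive c).
Proof. intros (Hx & Hy & Hz). split; [|split]; now apply smooth_on_Derive. Qed.

Lemma smooth_curve_vis_derive (D : R -> Prop) (c : R -> vec) (s : R) :
  smooth_curve_on D c -> D s -> vis_derive c s (vderive c s).
Proof.
  intros (Hx & Hy & Hz) Hs.
  split; [|split]; apply Derive_correct; [now apply (Hx 0%nat)|now apply (Hy 0%nat)|now apply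
    (Hz 0%nat)].
Qed.

Lemma vderive_ext (c d : R -> vec) (s : R) : (forall u, c u = d u) -> vderive c s = vderive d s.
Proof. intros H. apply vec_eq; apply Derive_ext; intros u; now rewrite H. Qed.

Lemma vderive_const (k : vec) (s : R) : vderive (fun _ => k) s = vzero.
Proof. unfold vderive, vzero; now rewrite !Derive_const. Qed.

Lemma vderive_vadd_r (c : R -> vec) (k : vec) (s : R) :
  vderive (fun u => vadd (c u) k) s = vderive c s.
Proof.
  (* The difference quotients coincide, so no differentiability of [f] is required. *)
  assert (E : forall f (l : R), Derive (fun u => f u + l) s = Derive f s).
  { intros f l. unfold Derive. f_equal. apply Lim_ext. intros h. f_equal. ring. }
  unfold vderive; f_equal; apply E.
Qed.

Lemma vadd_comm (u w : vec) : vadd u w = vadd w u.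
Proof. apply vec_eq; vunfold; ring. Qed.

Lemma X_s_translation (alpha beta : R -> vec) (s t : R) :
  X_s (translation_param alpha beta) s t = vderive alpha s.
Proof. apply vderive_vadd_r. Qed.

Lemma X_t_translation (alpha beta : R -> vec) (s t : R) :
  X_t (translation_param alpha beta) s t = vderive beta t.
Proof.
  rewrite <- (vderive_vadd_r beta (alpha s)). apply vderive_ext; intros u; apply vadd_comm.
Qed.

(** * Gauss curvature of a translation surface *)

Definition binormal (c : R -> vec) (s : R) : vec := vcross (vderive c s) (vderive (vderive c) s).

(** The mixed coefficient is 0, Lagrange's identity gives [E G - F^2 = |N|^2], and the triple
    products of [alpha''] and [beta''] with [N] are [- a . beta'] and [b . alpha']. The unit normal
    contributes the remaining factor [|N|^2]. *)
Lemma gauss_curvature_translation (alpha beta : R -> vec) (s t : R) :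
  let N := vcross (vderive alpha s) (vderive beta t) in
  N <> vzero ->
  gauss_curvature (translation_param alpha beta) s t * vdot N N ^ 2 =
  - (vdot (binormal alpha s) (vderive beta t) * vdot (binormal beta t) (vderive alpha s)).
Proof.
  intros N HN. unfold gauss_curvature. cbv zeta.
  rewrite (vderive_ext (fun u => X_s (translation_param alpha beta) u t) (vderive alpha))
    by (intros; apply X_s_translation).
  rewrite (vderive_ext (fun u => X_t (translation_param alpha beta) s u) (vderive beta))
    by (intros; apply X_t_translation).
  rewrite (vderive_ext (fun u => X_s (translation_param alpha beta) s u) (fun _ => vderive alpha s))
    by (intros; apply X_s_translation).
  rewrite X_s_translation, X_t_translation, vderive_const.
  unfold binormal.
  set (A1 := vderive alpha s) in *. set (B1 := vderive beta t) in *.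
  set (A2 := vderive (vderive alpha) s). set (B2 := vderive (vderive beta) t).
  assert (HP := vdot_pos N HN).
  assert (EN : vnorm N ^ 2 = vdot N N) by (apply pow2_sqrt; lra).
  assert (Pn : 0 < vnorm N) by (apply sqrt_lt_R0; exact HP).
  assert (EG : vdot A1 A1 * vdot B1 B1 - vdot A1 B1 * vdot A1 B1 = vdot N N)
    by (unfold N; vunfold; ring).
  rewrite EG, <- EN. fold N. set (r := vnorm N) in *.
  replace (vdot A2 (vscal (/ r) N)) with (- vdot (vcross A1 A2) B1 / r)
    by (unfold N; vunfold; field; lra).
  replace (vdot B2 (vscal (/ r) N)) with (vdot (vcross B1 B2) A1 / r)
    by (unfold N; vunfold; field; lra).
  replace (vdot vzero (vscal (/ r) N)) with 0 by (vunfold; ring).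
  field. lra.
Qed.

(** * Vectors in a plane with given normal *)

Lemma vcross_normal (u w n : vec) :
  vdot u n = 0 -> vdot w n = 0 ->
  vscal (vdot n n) (vcross u w) = vscal (vdot (vcross u w) n) n.
Proof.
  intros Hu Hw.
  transitivity (vadd (vscal (vdot (vcross u w) n) n)
    (vcross n (vsub (vscal (vdot u n) w) (vscal (vdot w n) u)))).
  - apply vec_eq; vunfold; ring.
  - rewrite Hu, Hw. apply vec_eq; vunfold; ring.
Qed.

Lemma vcross_unit_normal (u w n : vec) :
  vdot u n = 0 -> vdot w n = 0 -> vdot n n = 1 ->
  vcross u w = vscal (vdot (vcross u w) n) n.
Proof.
  intros Hu Hw Hn. rewrite <- vcross_normal, Hn by assumption.
  apply vec_eq; vunfold; ring.
Qed.

(** For nonzero [u], this expands [w] in the orthogonal frame [u], [n], [u x n], where [u x w] has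
    components along [u x n] and [n] only. It produces the factor [1 + u^2] of the separated
    equation. *)
Lemma vcross_sqr_adapted (u w n : vec) :
  vdot u n = 0 -> vdot n n = 1 ->
  vdot (vcross u w) (vcross u w) =
  vdot w n ^ 2 * vdot u u + vdot (vcross u n) w ^ 2.
Proof.
  intros Hu Hn.
  transitivity (vdot n n * vdot (vcross u w) (vcross u w)); [rewrite Hn; ring|].
  transitivity (vdot w n ^ 2 * vdot u u + vdot (vcross u n) w ^ 2
    + vdot u n * (vdot u n * vdot w w - 2 * vdot u w * vdot w n)).
  2: rewrite Hu; ring.
  vunfold; ring.
Qed.

Lemma is_derive_inv_sqrt (f : R -> R) (s df : R) :
  is_derive f s df -> 0 < f s ->
  is_derive (fun u => / sqrt (f u)) s (- df / (2 * sqrt (f s) ^ 3)).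
Proof.
  intros H HP. assert (Pn := sqrt_lt_R0 _ HP). assert (Q := is_derive_Derive (fun u => f u) _ _ H).
  auto_derive.
  - repeat split; [eexists; exact H|exact HP|lra].
  - rewrite Q. field. lra.
Qed.

(** Here [c] is already the velocity of the planar curve. Normalizing it leaves
    [(c1 x c2) x c1 / |c1|^3], and [c1 x c2] is a multiple of [n]: the unit tangent rotates in its
    plane, and the scalar factor is the angular speed. *)
Lemma unit_tangent_derive (c : R -> vec) (s : R) (c1 c2 n : vec) :
  c s = c1 -> vis_derive c s c2 -> c1 <> vzero ->
  vdot c1 n = 0 -> vdot c2 n = 0 -> vdot n n = 1 ->
  vis_derive (fun u => vscal (/ vnorm (c u)) (c u)) s
    (vscal (vdot (vcross c1 c2) n / vdot c1 c1) (vcross n (vscal (/ vnorm c1) c1))).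
Proof.
  intros E H H0 H1 H2 Hn.
  assert (HP := vdot_pos _ H0).
  assert (EN : vnorm c1 ^ 2 = vdot c1 c1) by (apply pow2_sqrt; lra).
  assert (Pn : 0 < vnorm c1) by (apply sqrt_lt_R0; exact HP).
  assert (Hd : is_derive (fun u => / vnorm (c u)) s (- vdot c1 c2 / vnorm c1 ^ 3)).
  { assert (Q := vis_derive_vdot _ _ _ _ _ H H).
    assert (HP' : 0 < vdot (c s) (c s)) by (rewrite E; exact HP).
    apply (is_derive_eq _ _ _ _ (is_derive_inv_sqrt (fun u => vdot (c u) (c u)) _ _ Q HP')).
    cbv beta. rewrite E. fold (vnorm c1). replace (vdot c2 c1) with (vdot c1 c2) by (vunfold; ring).
    field. lra. }
  apply (vis_derive_eq _ _ _ _ (vis_derive_vscal _ _ _ _ _ Hd H)).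
  rewrite E.
  transitivity (vscal (/ vnorm c1 ^ 3) (vcross (vcross c1 c2) c1)).
  - transitivity (vadd (vscal (- vdot c1 c2 / vnorm c1 ^ 3) c1)
      (vscal (vdot c1 c1 / vnorm c1 ^ 3) c2)).
    + f_equal. rewrite <- EN. apply vec_eq; vunfold; field; lra.
    + set (r := vnorm c1) in *. clearbody r. apply vec_eq; vunfold; field; lra.
  - rewrite (vcross_unit_normal c1 c2 n) at 1 by assumption. rewrite <- EN.
    set (r := vnorm c1) in *. set (q := vdot (vcross c1 c2) n). clearbody r q.
    apply vec_eq; vunfold; field; lra.
Qed.

(** * Planar generating curves *)

Lemma planar_on_unit_normal (D : R -> Prop) (c : R -> vec) :
  planar_on D c -> exists n h, vdot n n = 1 /\ forall s, D s -> vdot (c s) n = h.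
Proof.
  intros (p & nv & Hn & H).
  assert (HP := vdot_pos _ Hn). assert (Pn : 0 < vnorm nv) by (apply sqrt_lt_R0; exact HP).
  assert (EN : vnorm nv ^ 2 = vdot nv nv) by (apply pow2_sqrt; lra).
  exists (vscal (/ vnorm nv) nv), (vdot p nv / vnorm nv). split.
  - transitivity (vdot nv nv / vnorm nv ^ 2).
    + vunfold; field; lra.
    + rewrite EN; field; lra.
  - intros s Hs. specialize (H s Hs).
    transitivity ((vdot (vsub (c s) p) nv + vdot p nv) / vnorm nv).
    + vunfold; field; lra.
    + rewrite H; field; lra.
Qed.

Lemma vdot_const_derive (a b : Rbar) (c : R -> vec) (n : vec) (h : R) :
  smooth_curve_on (in_interval a b) c ->
  (forall s, in_interval a b s -> vdot (c s) n = h) ->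
  forall s, in_interval a b s -> vdot (vderive c s) n = 0.
Proof.
  intros Hc H s Hs.
  apply (derive_eq_on a b (fun s => vdot (c s) n) (fun _ => h) s); try easy.
  - now apply vis_derive_vdot_l, (smooth_curve_vis_derive (in_interval a b)).
  - apply (is_derive_const (V := R_NormedModule)).
Qed.

Lemma planar_translation_curvature_absurd (a1 b1 a2 b2 : Rbar) (alpha beta : R -> vec) (c : R) :
  Rbar_lt a1 b1 -> Rbar_lt a2 b2 ->
  smooth_curve_on (in_interval a1 b1) alpha ->
  smooth_curve_on (in_interval a2 b2) beta ->
  (forall s t, in_interval a1 b1 s -> in_interval a2 b2 t ->
    vcross (vderive alpha s) (vderive beta t) <> vzero) ->
  c <> 0 ->
  (forall s t, in_interval a1 b1 s -> in_interval a2 b2 t ->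
    let N := vcross (vderive alpha s) (vderive beta t) in
    c * vdot N N ^ 2 =
    - (vdot (binormal alpha s) (vderive beta t) * vdot (binormal beta t) (vderive alpha s))) ->
  planar_on (in_interval a1 b1) alpha -> False.
Proof.
  intros HI HJ Ha Hb HN Hc HK Hp.
  destruct (planar_on_unit_normal _ _ Hp) as (n & h & Hn & Hh).
  destruct (in_interval_inhabited a1 b1 HI) as [s0 Hs0].
  destruct (in_interval_inhabited a2 b2 HJ) as [t0 Ht0].
  set (A1 := vderive alpha) in *. set (A2 := vderive A1).
  set (B1 := vderive beta) in *. set (B2 := vderive B1).
  assert (Ha1 : smooth_curve_on (in_interval a1 b1) A1) by now apply smooth_curve_vderive.
  assert (Hb1 : smooth_curve_on (in_interval a2 b2) B1) by now apply smooth_curve_vderive.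
  assert (HA1 : forall s, in_interval a1 b1 s -> vdot (A1 s) n = 0)
    by now apply (vdot_const_derive _ _ _ _ h).
  assert (HA2 : forall s, in_interval a1 b1 s -> vdot (A2 s) n = 0)
    by now apply (vdot_const_derive _ _ _ _ 0).
  assert (NA : forall s, in_interval a1 b1 s -> A1 s <> vzero).
  { intros s Hs E. apply (HN s t0 Hs Ht0). rewrite E. apply vec_eq; vunfold; ring. }
  set (an := fun s => vdot (vcross (A1 s) (A2 s)) n).
  set (z := fun t => vdot (B1 t) n).
  set (rho := fun s => vnorm (A1 s)).
  assert (Hrho : forall s, in_interval a1 b1 s -> rho s <> 0 /\ rho s ^ 2 = vdot (A1 s) (A1 s)).
  { intros s Hs. assert (HP := vdot_pos _ (NA s Hs)). split.
    - apply Rgt_not_eq, sqrt_lt_R0, HP.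
    - apply pow2_sqrt; lra. }
  assert (Ea : forall s t, in_interval a1 b1 s -> in_interval a2 b2 t ->
    c * vdot (vcross (A1 s) (B1 t)) (vcross (A1 s) (B1 t)) ^ 2 =
    - (an s * z t * vdot (vcross (B1 t) (B2 t)) (A1 s))).
  { intros s t Hs Ht. rewrite (HK s t Hs Ht). unfold binormal.
    fold A1 A2 B1 B2.
    rewrite (vcross_unit_normal (A1 s) (A2 s) n) by auto.
    unfold z, an. vunfold; ring. }
  (* As [c] and [N] are nonzero, no factor on the right of [Ea] can vanish. This permits the
     division by [z] in [B] and makes the angular speed [om] nonzero. *)
  assert (Hnz : forall s t, in_interval a1 b1 s -> in_interval a2 b2 t -> an s <> 0 /\ z t <> 0).
  { intros s t Hs Ht.
    assert (Q : c * vdot (vcross (A1 s) (B1 t)) (vcross (A1 s) (B1 t)) ^ 2 <> 0).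
    { assert (P := vdot_pos _ (HN s t Hs Ht)).
      apply Rmult_integral_contrapositive_currified; [exact Hc|]. apply pow_nonzero; lra. }
    rewrite (Ea s t Hs Ht) in Q.
    split; intros E; apply Q; rewrite E; ring. }
  assert (Hz : forall t, in_interval a2 b2 t -> z t <> 0) by (intros t Ht; now apply (Hnz s0)).
  assert (Han : forall s, in_interval a1 b1 s -> an s <> 0) by (intros s Hs; now apply (Hnz s t0)).
  set (T := fun s => vscal (/ vnorm (A1 s)) (A1 s)).
  set (om := fun s => an s / vdot (A1 s) (A1 s)).
  set (B := fun t => vscal (/ z t) (B1 t)).
  set (B' := fun t => vscal (/ z t ^ 2) (vsub (vscal (z t) (B2 t)) (vscal (vdot (B2 t) n) (B1 t)))).
  assert (HT : forall s, in_interval a1 b1 s -> vis_derive T s (vscal (om s) (vcross n (T s)))).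
  { intros s Hs. apply unit_tangent_derive; auto.
    now apply (smooth_curve_vis_derive (in_interval a1 b1)). }
  assert (HTn : forall s, in_interval a1 b1 s -> vdot (T s) n = 0).
  { intros s Hs. transitivity (/ vnorm (A1 s) * vdot (A1 s) n).
    - unfold T; vunfold; ring.
    - rewrite HA1 by easy; ring. }
  (* [T] and [T x n] form a frame turning at speed [om]; this yields the derivatives of [u] and
     [w]. *)
  assert (HJ' : forall s, in_interval a1 b1 s ->
     vis_derive (fun s => vcross (T s) n) s (vscal (om s) (T s))).
  { intros s Hs.
    apply (vis_derive_eq _ _ _ _ (vis_derive_vcross _ _ _ _ _ (HT s Hs) (vis_derive_const n s))).
    transitivity (vscal (om s) (vsub (vscal (vdot n n) (T s)) (vscal (vdot (T s) n) n))).
    - apply vec_eq; vunfold; ring.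
    - rewrite Hn, HTn by easy. apply vec_eq; vunfold; ring. }
  assert (HB : forall t, in_interval a2 b2 t -> vis_derive B t (B' t)).
  { intros t Ht.
    assert (Q := smooth_curve_vis_derive _ _ _ Hb1 Ht).
    assert (Qz := is_derive_inv _ _ _ (vis_derive_vdot_l _ _ _ n Q) (Hz t Ht)).
    apply (vis_derive_eq _ _ _ _ (vis_derive_vscal _ _ _ _ _ Qz Q)).
    unfold B'. fold (z t). fold B2. assert (Hzt := Hz t Ht). generalize dependent (z t).
    intros zt Hzt. apply vec_eq; vunfold; field; exact Hzt. }
  apply (curvature_system_absurd a1 b1 a2 b2
    (fun s t => vdot (vcross (T s) n) (B t)) (fun s t => vdot (T s) (B t))
    (fun s t => vdot (vcross (T s) n) (B' t)) (fun s t => vdot (T s) (B' t))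
    om (fun s => - c * rho s ^ 3 / an s) z HI HJ).
  - intros s t Hs Ht.
    assert (Fl : forall k, - (om s * vdot (vcross (T s) n) k) = vdot (vscal (om s) (vcross n (T
      s))) k)
      by (intros k; vunfold; ring).
    assert (Fr : forall k, om s * vdot (T s) k = vdot (vscal (om s) (T s)) k)
      by (intros k; vunfold; ring).
    rewrite !Fl, !Fr.
    split; [|split; [|split; [|split; [|split; [|split]]]]].
    + exact (vis_derive_vdot_l _ _ _ _ (HJ' s Hs)).
    + exact (vis_derive_vdot_l _ _ _ _ (HT s Hs)).
    + exact (vis_derive_vdot_l _ _ _ _ (HJ' s Hs)).
    + exact (vis_derive_vdot_l _ _ _ _ (HT s Hs)).
    + exact (vis_derive_vdot_r _ _ _ _ (HB t Ht)).
    + exact (vis_derive_vdot_r _ _ _ _ (HB t Ht)).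
    + assert (Eb := Ea s t Hs Ht).
      rewrite (vcross_sqr_adapted (A1 s) (B1 t) n) in Eb by auto.
      fold (z t) in Eb.
      destruct (Hrho s Hs) as [Hr Er]. rewrite <- Er in Eb.
      assert (Hzt := Hz t Ht). assert (Hat := Han s Hs).
      (* The numerator of [(T x n) . B'] is [(B1 x B2) . (n x (A1 x n))] by the Binet-Cauchy
         identity, and [n x (A1 x n) = A1] because [n] is a unit vector orthogonal to [A1]. *)
      transitivity (vdot (vcross (B1 t) (B2 t)) (A1 s) / (rho s * z t ^ 2)).
      { transitivity ((vdot (vcross (B1 t) (B2 t)) (A1 s) * vdot n n
           - vdot (vcross (B1 t) (B2 t)) n * vdot (A1 s) n) / (rho s * z t ^ 2)).
        - unfold T, B'. fold (rho s).
          transitivity ((vdot (vcross (A1 s) n) (B2 t) * z t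
            - vdot (vcross (A1 s) n) (B1 t) * vdot (B2 t) n) / (rho s * z t ^ 2)).
          + generalize dependent (z t). intros zt. generalize dependent (rho s). intros.
            vunfold; field; split; assumption.
          + f_equal. unfold z. vunfold; ring.
        - rewrite Hn, HA1 by easy. f_equal. ring. }
      transitivity (- c * rho s ^ 3 / an s * z t *
        (1 + (vdot (vcross (A1 s) n) (B1 t) / (rho s * z t)) ^ 2) ^ 2).
      * set (q := vdot (vcross (A1 s) n) (B1 t)) in *.
        set (p := vdot (vcross (B1 t) (B2 t)) (A1 s)) in *.
        clearbody q p. generalize dependent (z t). generalize dependent (rho s).
        generalize dependent (an s). intros x Hx y Hy Ey' w Ew Hw.
        apply (Rmult_eq_reg_l (- (x * w * (y * w ^ 2)))).
        2: { apply Ropp_neq_0_compat. repeat apply Rmult_integral_contrapositive_currified;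
          auto with real. }
        transitivity (- (x * w * p)); [field; auto|]. rewrite <- Ew. field. auto.
      * f_equal. f_equal. f_equal. f_equal.
        unfold T, B. fold (rho s). generalize dependent (z t). generalize dependent (rho s). intros.
        vunfold; field; auto.
  - intros s Hs. destruct (Hrho s Hs) as [Hr Er]. assert (P := vdot_pos _ (NA s Hs)).
    assert (Q := Han s Hs). split.
    + unfold om. apply Rmult_integral_contrapositive_currified; [exact Q|].
      apply Rinv_neq_0_compat; lra.
    + apply Rmult_integral_contrapositive_currified; [|now apply Rinv_neq_0_compat].
      apply Rmult_integral_contrapositive_currified; [now apply Ropp_neq_0_compat|].
      now apply pow_nonzero.
  - exact Hz.
Qed.

(** * Flat translation surfaces *)

Lemma vscal_eq0 (l : R) (u : vec) : l <> 0 -> vscal l u = vzero -> u = vzero.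
Proof.
  intros Hl E. transitivity (vscal (/ l) (vscal l u)).
  - apply vec_eq; vunfold; field; exact Hl.
  - rewrite E. apply vec_eq; vunfold; ring.
Qed.

Lemma vcross_eq0_scal (u w : vec) : vcross u w = vzero -> vscal (vdot u u) w = vscal (vdot u w) u.
Proof.
  intros E.
  transitivity (vsub (vscal (vdot u w) u) (vcross u (vcross u w))).
  - apply vec_eq; vunfold; ring.
  - rewrite E. apply vec_eq; vunfold; ring.
Qed.

Lemma vcross_eq0_perp (u w k : vec) :
  u <> vzero -> vcross u w = vzero -> vdot u k = 0 -> vdot w k = 0.
Proof.
  intros Hu E Hk. assert (P := vdot_pos _ Hu).
  apply (Rmult_eq_reg_l (vdot u u)); [|lra].
  transitivity (vdot (vscal (vdot u u) w) k); [vunfold; ring|].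
  rewrite (vcross_eq0_scal _ _ E).
  transitivity (vdot u w * vdot u k); [vunfold; ring|]. rewrite Hk; ring.
Qed.

Lemma vcross_perp_plane (u w a : vec) :
  vdot a u = 0 -> vdot a w = 0 -> vcross (vcross u w) a = vzero.
Proof.
  intros Hu Hw. transitivity (vsub (vscal (vdot a u) w) (vscal (vdot a w) u)).
  - apply vec_eq; vunfold; ring.
  - rewrite Hu, Hw. apply vec_eq; vunfold; ring.
Qed.

Lemma vcross_two_normals (u w a b : vec) :
  vcross u w <> vzero -> vdot a u = 0 -> vdot a w = 0 -> vdot b u = 0 -> vdot b w = 0 ->
  vcross a b = vzero.
Proof.
  intros HN Hau Haw Hbu Hbw. assert (P := vdot_pos _ HN).
  apply (vscal_eq0 (vdot (vcross u w) (vcross u w) ^ 2)); [apply pow_nonzero; lra|].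
  assert (Ea := vcross_eq0_scal _ _ (vcross_perp_plane u w a Hau Haw)).
  assert (Eb := vcross_eq0_scal _ _ (vcross_perp_plane u w b Hbu Hbw)).
  set (N := vcross u w) in *.
  transitivity (vcross (vscal (vdot N N) a) (vscal (vdot N N) b)).
  - apply vec_eq; vunfold; ring.
  - rewrite Ea, Eb. apply vec_eq; vunfold; ring.
Qed.

(** The square of the triple product of [q], [n], [v] is their Gram determinant, which under the
    orthogonality hypotheses reduces to [|q|^2 |n|^2 |v|^2]. *)
Lemma vdot_frame_eq0 (q v n : vec) :
  v <> vzero -> n <> vzero -> vdot v n = 0 ->
  vdot q v = 0 -> vdot q n = 0 -> vdot q (vcross n v) = 0 -> q = vzero.
Proof.
  intros Hv Hn Hvn Qv Qn Qw.
  assert (Pv := vdot_pos _ Hv). assert (Pn := vdot_pos _ Hn).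
  destruct (classic (q = vzero)) as [E|E]; [exact E|exfalso].
  assert (Pq := vdot_pos _ E).
  assert (G : vdot q (vcross n v) ^ 2 = vdot q q * (vdot n n * vdot v v)
    + 2 * vdot q v * vdot q n * vdot v n - vdot q q * vdot v n ^ 2
    - vdot n n * vdot q v ^ 2 - vdot v v * vdot q n ^ 2) by (vunfold; ring).
  rewrite Qw, Hvn, Qv, Qn in G.
  assert (0 < vdot q q * (vdot n n * vdot v v)) by now repeat apply Rmult_lt_0_compat.
  lra.
Qed.

Lemma vderive_0_const (a b : Rbar) (c : R -> vec) :
  (forall s, in_interval a b s -> vis_derive c s vzero) ->
  forall s s', in_interval a b s -> in_interval a b s' -> c s = c s'.
Proof.
  intros H s s' Hs Hs'.
  apply vec_eq.
  - apply (derive_0_const a b (fun u => vx (c u))); auto; intros x Hx; apply (H x Hx).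
  - apply (derive_0_const a b (fun u => vy (c u))); auto; intros x Hx; apply (H x Hx).
  - apply (derive_0_const a b (fun u => vz (c u))); auto; intros x Hx; apply (H x Hx).
Qed.

(* Since [|c'|^2 c'' = (c'.c'') c' + (c' x c'') x c'], the cosine of the angle
   between [c'] and a vector parallel to [c' x c''] does not change. *)
Lemma tangent_perp_parallel_binormal (a b : Rbar) (c : R -> vec) (n : vec) (s0 : R) :
  smooth_curve_on (in_interval a b) c ->
  (forall s, in_interval a b s -> vderive c s <> vzero) ->
  (forall s, in_interval a b s -> vcross (binormal c s) n = vzero) ->
  in_interval a b s0 -> vdot (vderive c s0) n = 0 ->
  forall s, in_interval a b s -> vdot (vderive c s) n = 0.
Proof.
  intros Hc Hreg Hb Hs0 H0 s Hs.
  set (c1 := vderive c) in *. set (c2 := vderive c1).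
  assert (Hd : forall u, in_interval a b u -> vis_derive c1 u (c2 u)).
  { intros u Hu. apply (smooth_curve_vis_derive (in_interval a b)); [|exact Hu].
    now apply smooth_curve_vderive. }
  (* The squared cosine, up to the constant [|n|^2], so that no root has to be differentiated. *)
  assert (E : vdot (c1 s) n ^ 2 / vdot (c1 s) (c1 s) = vdot (c1 s0) n ^ 2 / vdot (c1 s0) (c1 s0)).
  { apply (derive_0_const a b (fun u => vdot (c1 u) n ^ 2 / vdot (c1 u) (c1 u))); try easy.
    intros u Hu.
    assert (P := vdot_pos _ (Hreg u Hu)).
    assert (D1 := vis_derive_vdot_l _ _ _ n (Hd u Hu)).
    assert (D2 := vis_derive_vdot _ _ _ _ _ (Hd u Hu) (Hd u Hu)).
    set (f := fun u => vdot (c1 u) n) in *. set (q := fun u => vdot (c1 u) (c1 u)) in *.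
    change (is_derive (fun u => f u ^ 2 / q u) u 0).
    assert (Q1 := is_derive_Derive (fun u => f u) _ _ D1).
    assert (Q2 := is_derive_Derive (fun u => q u) _ _ D2).
    auto_derive.
    - repeat split; [eexists; exact D1|eexists; exact D2|apply Rgt_not_eq, P].
    - rewrite Q1, Q2.
      assert (E : vdot (c2 u) n * q u - f u * vdot (c1 u) (c2 u) = 0).
      { transitivity (- vdot (vcross (binormal c u) n) (c1 u)).
        - unfold q, f, binormal. fold c1 c2. vunfold; ring.
        - rewrite Hb by exact Hu. vunfold; ring. }
      transitivity (2 * f u * (vdot (c2 u) n * q u - f u * vdot (c1 u) (c2 u)) / q u ^ 2).
      + replace (vdot (c2 u) (c1 u)) with (vdot (c1 u) (c2 u)) by (vunfold; ring).
        field. apply Rgt_not_eq, P.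
      + rewrite E. field. apply Rgt_not_eq, P. }
  assert (P := vdot_pos _ (Hreg s Hs)).
  rewrite H0 in E.
  assert (E' : vdot (c1 s) n ^ 2 = 0).
  { replace (vdot (c1 s) n ^ 2) with (vdot (c1 s) n ^ 2 / vdot (c1 s) (c1 s) * vdot (c1 s) (c1 s))
      by (field; lra).
    rewrite E. unfold Rdiv; ring. }
  destruct (Req_dec (vdot (c1 s) n) 0) as [Z|Z]; [exact Z|].
  now apply (pow_nonzero _ 2) in Z.
Qed.

(** The velocity stays parallel to [v], so the curve is [c s1] plus [G - G s1] times [v]. Since [G]
    has nonzero derivative at [s1], it takes all values near [G s1]. *)
Lemma straight_curve_segments (a b : Rbar) (c : R -> vec) (s0 : R) :
  smooth_curve_on (in_interval a b) c ->
  (forall s, in_interval a b s -> vderive c s <> vzero) ->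
  (forall s, in_interval a b s -> binormal c s = vzero) ->
  in_interval a b s0 ->
  forall s, in_interval a b s -> exists eps, 0 < eps /\
    forall l, Rabs l < eps -> exists s', in_interval a b s' /\
      c s' = vadd (c s) (vscal l (vderive c s0)).
Proof.
  intros Hc Hreg Hb Hs0 s1 Hs1.
  set (v := vderive c s0). assert (Pv := vdot_pos v (Hreg s0 Hs0)).
  set (lam := fun s => vdot (vderive c s) v / vdot v v).
  assert (Hl : forall s, in_interval a b s -> vderive c s = vscal (lam s) v).
  (* With zero binormals every vector counts as parallel to them. The choice of [n] as the part of
     [c' s] orthogonal to [v] then forces [n . n = 0]. *)
  { intros s Hs. set (n := vsub (vderive c s) (vscal (lam s) v)).
    assert (Hn : vdot v n = 0).
    { unfold n, lam. set (x := vderive c s).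
      transitivity (vdot x v - vdot x v / vdot v v * vdot v v); [|field; lra].
      set (y := vdot x v / vdot v v). vunfold; ring. }
    assert (Hn' : vdot (vderive c s) n = 0).
    { apply (tangent_perp_parallel_binormal a b c n s0); auto.
      intros u Hu. rewrite Hb by exact Hu. apply vec_eq; vunfold; ring. }
    destruct (classic (n = vzero)) as [E|E].
    - transitivity (vadd n (vscal (lam s) v)).
      + unfold n; apply vec_eq; vunfold; ring.
      + rewrite E; apply vec_eq; vunfold; ring.
    - exfalso. apply vdot_pos in E.
      assert (vdot n n = vdot (vderive c s) n - lam s * vdot v n) by (unfold n; vunfold; ring).
      rewrite Hn, Hn' in *; lra. }
  set (G := fun s => vdot (c s) v / vdot v v).
  assert (Hd : forall s, in_interval a b s -> vis_derive c s (vderive c s))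
    by (intros s Hs; now apply (smooth_curve_vis_derive (in_interval a b))).
  assert (HG : forall s, in_interval a b s -> is_derive G s (lam s)).
  { intros s Hs. unfold G, lam, Rdiv.
    assert (D := vis_derive_vdot_l _ _ _ v (Hd s Hs)).
    apply (is_derive_scal_l (fun s => vdot (c s) v) s _ (/ vdot v v)) in D. exact D. }
  assert (Hlin : forall s, in_interval a b s -> c s = vadd (c s1) (vscal (G s - G s1) v)).
  { intros s Hs.
    assert (E : vadd (c s) (vscal (-1 * G s) v) = vadd (c s1) (vscal (-1 * G s1) v)).
    { apply (vderive_0_const a b (fun u => vadd (c u) (vscal (-1 * G u) v))); auto.
      intros u Hu.
      assert (Hd1 := Hd u Hu). rewrite (Hl u Hu) in Hd1. destruct Hd1 as (D1 & D2 & D3).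
      assert (DG := HG u Hu).
      assert (QG := is_derive_Derive (fun u => G u) _ _ DG).
      assert (Comp : forall f k, is_derive f u (lam u * k) ->
        is_derive (fun u => f u + -1 * G u * k) u 0).
      { intros f k Hf. assert (Qf := is_derive_Derive (fun u => f u) _ _ Hf).
        auto_derive; [repeat split; eexists; [exact Hf|exact DG]|]. rewrite Qf, QG. ring. }
      split; [|split]; apply Comp; assumption. }
    transitivity (vadd (vadd (c s) (vscal (-1 * G s) v)) (vscal (G s) v)).
    - apply vec_eq; vunfold; ring.
    - rewrite E. apply vec_eq; vunfold; ring. }
  destruct (proj1 (locally_Rabs _ _) (in_interval_locally a b s1 Hs1)) as [d [Hd0 Hin]].
  destruct (derive_neq0_values G s1 d (lam s1) Hd0) as [e [He H]].
  - intros x Hx. apply (is_derive_continuous _ _ (lam x)), HG, Hin, Hx.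
  - now apply HG.
  - intros E. apply (Hreg s1 Hs1). rewrite Hl, E by exact Hs1. apply vec_eq; vunfold; ring.
  - exists e; split; [exact He|]. intros l L.
    destruct (H l L) as [s [Hs E]]. exists s. split; [now apply Hin|].
    rewrite (Hlin s) by now apply Hin. rewrite E. f_equal. f_equal. ring.
Qed.

Lemma trace_translation_swap (D1 D2 : R -> Prop) (alpha beta : R -> vec) (p : vec) :
  trace D1 D2 (translation_param alpha beta) p -> trace D2 D1 (translation_param beta alpha) p.
Proof.
  intros (s & t & Hs & Ht & E). exists t, s. split; [exact Ht|split; [exact Hs|]].
  rewrite <- E. apply vadd_comm.
Qed.

Lemma cylindrical_ext (S S' : vec -> Prop) :
  (forall p, S p <-> S' p) -> cylindrical S -> cylindrical S'.
Proof.
  intros E (v & Hv & H). exists v; split; [exact Hv|]. intros p Hp.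
  destruct (H p (proj2 (E p) Hp)) as [e [He Hl]]. exists e; split; [exact He|].
  intros l L. now apply E, Hl.
Qed.

Lemma straight_translation_cylindrical (a1 b1 : Rbar) (D : R -> Prop) (alpha beta : R -> vec) :
  Rbar_lt a1 b1 ->
  smooth_curve_on (in_interval a1 b1) alpha ->
  (forall s, in_interval a1 b1 s -> vderive alpha s <> vzero) ->
  (forall s, in_interval a1 b1 s -> binormal alpha s = vzero) ->
  cylindrical (trace (in_interval a1 b1) D (translation_param alpha beta)).
Proof.
  intros HI Ha Hreg Hb. destruct (in_interval_inhabited a1 b1 HI) as [s0 Hs0].
  exists (vderive alpha s0). split; [now apply Hreg|].
  intros p (s & t & Hs & Ht & <-).
  destruct (straight_curve_segments a1 b1 alpha s0 Ha Hreg Hb Hs0 s Hs) as [e [He H]].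
  exists e; split; [exact He|]. intros l L. destruct (H l L) as [s' [Hs' E]].
  exists s', t. split; [exact Hs'|split; [exact Ht|]]. unfold translation_param. rewrite E.
  apply vec_eq; vunfold; ring.
Qed.

(** The surface is an open piece of a plane, so any tangent direction could serve as ruling;
    [alpha' s0] is taken. Instead of a planar inverse function theorem, one equation is solved for
    [t] as a function of [s], which keeps the coordinate along [w = n x v] fixed, and the coordinate
    along [v] is then varied through [s]. *)
Lemma coplanar_translation_cylindrical (a1 b1 a2 b2 : Rbar) (alpha beta : R -> vec) (n : vec) :
  Rbar_lt a1 b1 ->
  smooth_curve_on (in_interval a1 b1) alpha ->
  smooth_curve_on (in_interval a2 b2) beta ->
  (forall s t, in_interval a1 b1 s -> in_interval a2 b2 t ->
    vcross (vderive alpha s) (vderive beta t) <> vzero) ->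
  n <> vzero ->
  (forall s, in_interval a1 b1 s -> vdot (vderive alpha s) n = 0) ->
  (forall t, in_interval a2 b2 t -> vdot (vderive beta t) n = 0) ->
  cylindrical (trace (in_interval a1 b1) (in_interval a2 b2) (translation_param alpha beta)).
Proof.
  intros HI Ha Hb HN Hn HAn HBn.
  destruct (classic (exists t, in_interval a2 b2 t)) as [[t0 Ht0]|Hempty].
  2: { exists n; split; [exact Hn|]. intros p (s & t & _ & Ht & _). exfalso; eauto. }
  destruct (in_interval_inhabited a1 b1 HI) as [s0 Hs0].
  set (A1 := vderive alpha) in *. set (B1 := vderive beta) in *.
  set (v := A1 s0). set (w := vcross n v).
  assert (Hv : v <> vzero).
  { intros E. apply (HN s0 t0 Hs0 Ht0). fold v. rewrite E. apply vec_eq; vunfold; ring. }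
  assert (Pv := vdot_pos _ Hv). assert (Pn := vdot_pos _ Hn).
  assert (HNn : forall s t, in_interval a1 b1 s -> in_interval a2 b2 t ->
    vdot (vcross (A1 s) (B1 t)) n <> 0).
  { intros s t Hs Ht E. apply (HN s t Hs Ht). apply (vscal_eq0 (vdot n n)); [lra|].
    rewrite vcross_normal, E by auto. apply vec_eq; vunfold; ring. }
  assert (HwB : forall t, in_interval a2 b2 t -> vdot w (B1 t) <> 0).
  { intros t Ht E. apply (HNn s0 t Hs0 Ht). rewrite <- E. unfold w, v. vunfold; ring. }
  exists v. split; [exact Hv|]. intros p (s1 & t1 & Hs1 & Ht1 & <-).
  assert (DA : forall k s, in_interval a1 b1 s -> is_derive (fun s => vdot k (alpha s)) s (vdot
    k (A1 s))).
  { intros k s Hs. apply vis_derive_vdot_r. now apply (smooth_curve_vis_derive (in_interval a1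
    b1)). }
  assert (DB : forall k t, in_interval a2 b2 t -> is_derive (fun t => vdot k (beta t)) t (vdot
    k (B1 t))).
  { intros k t Ht. apply vis_derive_vdot_r. now apply (smooth_curve_vis_derive (in_interval a2
    b2)). }
  set (phi := fun s => vdot w (alpha s)). set (psi := fun t => vdot w (beta t)).
  destruct (proj1 (locally_Rabs _ _) (in_interval_locally a2 b2 t1 Ht1)) as [d2 [Hd2 Hin2]].
  destruct (local_inverse psi (fun t => vdot w (B1 t)) t1 d2) as (g & e & He & Hg0 & Dg & Hg).
  { exact Hd2. }
  { intros t Ht. now apply DB, Hin2. }
  { apply (is_derive_continuous _ _ (vdot w (vderive B1 t1))).
    apply vis_derive_vdot_r, (smooth_curve_vis_derive (in_interval a2 b2)); [|exact Ht1].
    now apply smooth_curve_vderive. }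
  { now apply HwB. }
  (* The point moves along the line through [X s1 t1] of direction [v] when [t = tau s]. *)
  set (tau := fun s => g (psi t1 + phi s1 - phi s)).
  assert (Hloc : locally s1 (fun s => in_interval a1 b1 s /\ Rabs (phi s - phi s1) < e)).
  { apply filter_and; [now apply in_interval_locally|].
    apply (is_derive_continuous phi s1 _ (DA w s1 Hs1) (fun y => Rabs (y - phi s1) < e)).
    apply locally_Rabs. exists e; auto. }
  destruct (proj1 (locally_Rabs _ _) Hloc) as [d [Hd Hin]].
  assert (Hshift : forall s, Rabs (phi s - phi s1) < e -> Rabs (psi t1 + phi s1 - phi s - psi
    t1) < e).
  { intros s L. replace (psi t1 + phi s1 - phi s - psi t1) with (- (phi s - phi s1)) by ring.
    now rewrite Rabs_Ropp. }
  assert (Htau : forall s, Rabs (s - s1) < d -> in_interval a2 b2 (tau s) /\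
    psi (tau s) = psi t1 + phi s1 - phi s /\ continuous tau s).
  { intros s Hs. destruct (Hin s Hs) as [Hs' L].
    destruct (Hg _ (Hshift s L)) as (G1 & G2 & G3).
    split; [now apply Hin2|]. split; [exact G2|].
    apply (continuous_comp (fun s => psi t1 + phi s1 - phi s) g); [|exact G3].
    apply (continuous_minus (fun _ => psi t1 + phi s1) phi); [apply continuous_const|].
    apply (is_derive_continuous _ _ _ (DA w s Hs')). }
  assert (Et1 : tau s1 = t1).
  { unfold tau. replace (psi t1 + phi s1 - phi s1) with (psi t1) by ring. exact Hg0. }
  assert (Dtau : is_derive tau s1 (- vdot w (A1 s1) / vdot w (B1 t1))).
  { apply (is_derive_eq _ _ (- vdot w (A1 s1) * / vdot w (B1 t1))); [|reflexivity].
    apply (is_derive_comp g (fun s => psi t1 + phi s1 - phi s)).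
    - replace (psi t1 + phi s1 - phi s1) with (psi t1) by ring. exact Dg.
    - assert (Q := is_derive_Derive (fun s => phi s) _ _ (DA w s1 Hs1)).
      auto_derive; [eexists; exact (DA w s1 Hs1)|]. rewrite Q. ring. }
  (* The coordinate along [v] of the moving point, in multiples of [v]. *)
  set (F := fun s => (vdot v (alpha s) + vdot v (beta (tau s))) / vdot v v).
  destruct (derive_neq0_values F s1 d
    ((vdot v (A1 s1) + - vdot w (A1 s1) / vdot w (B1 t1) * vdot v (B1 t1)) / vdot v v) Hd)
    as (e' & He' & HF).
  { intros s Hs. destruct (Htau s Hs) as (T1 & T2 & T3). destruct (Hin s Hs) as [Hs' _].
    apply (continuous_scal_l (fun s => vdot v (alpha s) + vdot v (beta (tau s))) (/ vdot v v)).
    apply (continuous_plus (fun s => vdot v (alpha s)) (fun s => vdot v (beta (tau s)))).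
    - apply (is_derive_continuous _ _ _ (DA v s Hs')).
    - apply (continuous_comp tau (fun t => vdot v (beta t))); [exact T3|].
      apply (is_derive_continuous _ _ _ (DB v _ T1)). }
  { apply (is_derive_scal_l (fun s => vdot v (alpha s) + vdot v (beta (tau s))) s1 _ (/ vdot v v)).
    apply (is_derive_plus (fun s => vdot v (alpha s)) (fun s => vdot v (beta (tau s)))).
    - now apply DA.
    - apply (is_derive_comp (fun t => vdot v (beta t)) tau); [|exact Dtau].
      rewrite Et1. now apply DB. }
  (* Multiplied by [|v|^2 (w . beta')], this derivative becomes [(alpha' x beta') . (v x w)], and
     [v x w = |v|^2 n]; it vanishes only if the surface is not regular. *)
  { assert (Q := HwB t1 Ht1). intros E.
    apply (HNn s1 t1 Hs1 Ht1).
    apply (Rmult_eq_reg_l (vdot v v)); [|lra].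
    transitivity (vdot v (A1 s1) * vdot w (B1 t1) - vdot v (B1 t1) * vdot w (A1 s1)
      + vdot v n * vdot v (vcross (A1 s1) (B1 t1))).
    - unfold w. vunfold; ring.
    - replace (vdot v n) with 0 by (symmetry; now apply HAn).
      transitivity (vdot w (B1 t1) * vdot v v * ((vdot v (A1 s1)
        + - vdot w (A1 s1) / vdot w (B1 t1) * vdot v (B1 t1)) / vdot v v)).
      + field. split; [exact Q|lra].
      + rewrite E. ring. }
  exists e'. split; [exact He'|]. intros l L. destruct (HF l L) as (s & Hs & E).
  destruct (Htau s Hs) as (T1 & T2 & _). destruct (Hin s Hs) as [Hs' _].
  exists s, (tau s). split; [exact Hs'|split; [exact T1|]].
  unfold translation_param.
  assert (Cn : vdot n (alpha s) = vdot n (alpha s1) /\ vdot n (beta (tau s)) = vdot n (beta t1)).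
  { split.
    - apply (derive_0_const a1 b1 (fun s => vdot n (alpha s))); auto. intros x Hx.
      apply (is_derive_eq _ _ _ _ (DA n x Hx)). rewrite <- (HAn x Hx). vunfold; ring.
    - apply (derive_0_const a2 b2 (fun s => vdot n (beta s))); auto. intros x Hx.
      apply (is_derive_eq _ _ _ _ (DB n x Hx)). rewrite <- (HBn x Hx). vunfold; ring. }
  destruct Cn as [Cn1 Cn2].
  (* The components along [v], [n] and [w] agree by the choice of [s], by coplanarity and by the
     choice of [tau], respectively. *)
  assert (Q0 : vsub (vadd (alpha s) (beta (tau s))) (vadd (vadd (alpha s1) (beta t1)) (vscal l
    v)) = vzero).
  { apply (vdot_frame_eq0 _ v n Hv Hn); [now apply HAn| | |].
    - unfold F in E. rewrite Et1 in E.
      assert (E' : vdot v (alpha s) + vdot v (beta (tau s)) =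
        vdot v (alpha s1) + vdot v (beta t1) + l * vdot v v).
      { apply (Rmult_eq_reg_r (/ vdot v v)); [|apply Rinv_neq_0_compat; lra].
        unfold Rdiv in E. rewrite E. field. lra. }
      transitivity (vdot v (alpha s) + vdot v (beta (tau s)) -
        (vdot v (alpha s1) + vdot v (beta t1) + l * vdot v v)); [vunfold; ring|lra].
    - transitivity (vdot n (alpha s) + vdot n (beta (tau s)) - vdot n (alpha s1) - vdot n (beta t1)
        - l * vdot v n); [vunfold; ring|].
      replace (vdot v n) with 0 by (symmetry; now apply HAn). lra.
    - transitivity (phi s + psi (tau s) - phi s1 - psi t1).
      + unfold phi, psi, w. vunfold; ring.
      + rewrite T2; ring. }
  transitivity (vadd (vsub (vadd (alpha s) (beta (tau s)))
    (vadd (vadd (alpha s1) (beta t1)) (vscal l v))) (vadd (vadd (alpha s1) (beta t1)) (vscal l v))).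
  - apply vec_eq; vunfold; ring.
  - rewrite Q0. apply vec_eq; vunfold; ring.
Qed.

(** Meant for [b1] and [k] the velocity and binormal of the other curve at a fixed parameter. If the
    first factor is nonzero at [s], it is so nearby, where [k . c'] must vanish together with its
    derivative [k . c'']. Then [c' x c''] is parallel to [k], which is orthogonal to [b1]. *)
Lemma flat_binormal_perp (a b : Rbar) (c : R -> vec) (b1 k : vec) (s : R) :
  smooth_curve_on (in_interval a b) c ->
  (forall s, in_interval a b s -> vdot (binormal c s) b1 * vdot k (vderive c s) = 0) ->
  in_interval a b s -> k <> vzero -> vdot k b1 = 0 -> vdot (binormal c s) b1 = 0.
Proof.
  intros Hc H Hs Hk Hkb.
  destruct (Req_dec (vdot (binormal c s) b1) 0) as [Z|Z]; [exact Z|].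
  set (c1 := vderive c) in *. set (c2 := vderive c1) in *.
  assert (Hc1 : smooth_curve_on (in_interval a b) c1) by now apply smooth_curve_vderive.
  assert (Hc2 : smooth_curve_on (in_interval a b) c2) by now apply smooth_curve_vderive.
  assert (D1 := smooth_curve_vis_derive _ _ _ Hc1 Hs).
  assert (D2 := smooth_curve_vis_derive _ _ _ Hc2 Hs).
  assert (Hcont : continuous (fun s => vdot (binormal c s) b1) s).
  { eapply is_derive_continuous. apply vis_derive_vdot_l.
    apply (vis_derive_vcross c1 c2); eassumption. }
  assert (Hloc : locally s (fun u => vdot k (c1 u) = 0)).
  { assert (L : locally s (fun u => in_interval a b u /\ vdot (binormal c u) b1 <> 0)).
    { apply filter_and; [now apply in_interval_locally|].
      apply (Hcont (fun y => y <> 0)). now apply open_neq. }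
    revert L; apply filter_imp. intros u [Hu Hn].
    destruct (Rmult_integral _ _ (H u Hu)); easy. }
  assert (E1 : vdot k (c1 s) = 0) by exact (locally_singleton _ _ Hloc).
  assert (E2 : vdot k (c2 s) = 0).
  { apply (is_derive_R_unique (fun u => vdot k (c1 u)) s).
    - now apply vis_derive_vdot_r.
    - apply (is_derive_ext_loc (fun _ => 0)).
      + revert Hloc; apply filter_imp; auto.
      + apply (is_derive_const (V := R_NormedModule)). }
  apply (vcross_eq0_perp k); auto.
  transitivity (vsub (vscal (vdot k (c2 s)) (c1 s)) (vscal (vdot k (c1 s)) (c2 s))).
  - unfold binormal. fold c1 c2. apply vec_eq; vunfold; ring.
  - rewrite E1, E2. apply vec_eq; vunfold; ring.
Qed.

Lemma flat_translation_cylindrical (a1 b1 a2 b2 : Rbar) (alpha beta : R -> vec) :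
  Rbar_lt a1 b1 -> Rbar_lt a2 b2 ->
  smooth_curve_on (in_interval a1 b1) alpha ->
  smooth_curve_on (in_interval a2 b2) beta ->
  (forall s t, in_interval a1 b1 s -> in_interval a2 b2 t ->
    vcross (vderive alpha s) (vderive beta t) <> vzero) ->
  (forall s t, in_interval a1 b1 s -> in_interval a2 b2 t ->
    vdot (binormal alpha s) (vderive beta t) * vdot (binormal beta t) (vderive alpha s) = 0) ->
  cylindrical (trace (in_interval a1 b1) (in_interval a2 b2) (translation_param alpha beta)).
Proof.
  intros HI HJ Ha Hb HN HK.
  destruct (in_interval_inhabited a1 b1 HI) as [s2 Hs2].
  destruct (in_interval_inhabited a2 b2 HJ) as [t2 Ht2].
  assert (NA : forall s, in_interval a1 b1 s -> vderive alpha s <> vzero).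
  { intros s Hs E. apply (HN s t2 Hs Ht2). rewrite E. apply vec_eq; vunfold; ring. }
  assert (NB : forall t, in_interval a2 b2 t -> vderive beta t <> vzero).
  { intros t Ht E. apply (HN s2 t Hs2 Ht). rewrite E. apply vec_eq; vunfold; ring. }
  destruct (classic (exists s, in_interval a1 b1 s /\ binormal alpha s <> vzero))
    as [[s0 [Hs0 Na0]]|Zero].
  2: { apply straight_translation_cylindrical; auto. intros s Hs.
       apply NNPP. intros E. eauto. }
  destruct (classic (exists t, in_interval a2 b2 t /\ binormal beta t <> vzero))
    as [[t0 [Ht0 Nb0]]|Zero].
  2: { apply (cylindrical_ext (trace (in_interval a2 b2) (in_interval a1 b1)
         (translation_param beta alpha))).
       - intros p; split; apply trace_translation_swap.
       - apply straight_translation_cylindrical; auto. intros t Ht.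
         apply NNPP. intros E. eauto. }
  assert (Self : forall c s, vdot (binormal c s) (vderive c s) = 0)
    by (intros; unfold binormal; vunfold; ring).
  assert (Pa : forall s t, in_interval a1 b1 s -> in_interval a2 b2 t ->
    binormal beta t <> vzero -> vdot (binormal alpha s) (vderive beta t) = 0).
  { intros s t Hs Ht Nb. apply (flat_binormal_perp a1 b1 alpha _ (binormal beta t)); auto. }
  assert (Pb : forall s t, in_interval a1 b1 s -> in_interval a2 b2 t ->
    binormal alpha s <> vzero -> vdot (binormal beta t) (vderive alpha s) = 0).
  { intros s t Hs Ht Na. apply (flat_binormal_perp a2 b2 beta _ (binormal alpha s)); auto.
    intros t' Ht'. rewrite Rmult_comm. auto. }
  assert (Par : forall s t, in_interval a1 b1 s -> in_interval a2 b2 t ->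
    binormal alpha s <> vzero -> binormal beta t <> vzero ->
    vcross (binormal alpha s) (binormal beta t) = vzero).
  { intros s t Hs Ht Na Nb.
    apply (vcross_two_normals (vderive alpha s) (vderive beta t)); auto. }
  apply (coplanar_translation_cylindrical _ _ _ _ _ _ (binormal beta t0)); auto.
  - apply (tangent_perp_parallel_binormal _ _ _ _ s0); auto.
    (* Parallelism in the form of a vanishing cross product also covers the parameters where the
       binormal is zero. *)
    + intros s Hs. destruct (classic (binormal alpha s = vzero)) as [E|E].
      * rewrite E. apply vec_eq; vunfold; ring.
      * now apply Par.
    + transitivity (vdot (binormal beta t0) (vderive alpha s0)); [vunfold; ring|auto].
  - intros t Ht.
    (* [Par] compares binormals of different curves only, so [beta] is first shown orthogonal to
       [binormal alpha s0], and this is carried over to the parallel vector [binormal beta t0]. *)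
    assert (E : vdot (vderive beta t) (binormal alpha s0) = 0).
    { apply (tangent_perp_parallel_binormal a2 b2 beta (binormal alpha s0) t0); auto.
      + intros t' Ht'. rewrite vcross_anticomm.
        destruct (classic (binormal beta t' = vzero)) as [E|E].
        * rewrite E. apply vec_eq; vunfold; ring.
        * rewrite Par by assumption. apply vec_eq; vunfold; ring.
      + transitivity (vdot (binormal alpha s0) (vderive beta t0)); [vunfold; ring|auto]. }
    transitivity (vdot (binormal beta t0) (vderive beta t)); [vunfold; ring|].
    apply (vcross_eq0_perp (binormal alpha s0)); auto.
    rewrite <- E. vunfold; ring.
Qed.

Theorem theorem1 (a1 b1 a2 b2 : Rbar) (alpha beta : R -> vec) :
  Rbar_lt a1 b1 -> Rbar_lt a2 b2 ->
  smooth_curve_on (in_interval a1 b1) alpha ->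
  smooth_curve_on (in_interval a2 b2) beta ->
  regular_on (in_interval a1 b1) (in_interval a2 b2) (translation_param alpha beta) ->
  ((forall s t, in_interval a1 b1 s -> in_interval a2 b2 t ->
       gauss_curvature (translation_param alpha beta) s t = 0) ->
     cylindrical (trace (in_interval a1 b1) (in_interval a2 b2)
                   (translation_param alpha beta)))
  /\
  ((planar_on (in_interval a1 b1) alpha \/ planar_on (in_interval a2 b2) beta) ->
     ~ (exists c : R, c <> 0 /\
          forall s t, in_interval a1 b1 s -> in_interval a2 b2 t ->
            gauss_curvature (translation_param alpha beta) s t = c)).
Proof.
  intros HI HJ Ha Hb Hreg.
  assert (HN : forall s t, in_interval a1 b1 s -> in_interval a2 b2 t ->
    vcross (vderive alpha s) (vderive beta t) <> vzero).
  { intros s t Hs Ht. generalize (Hreg s t Hs Ht).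
    now rewrite X_s_translation, X_t_translation. }
  split.
  - intros HK. apply flat_translation_cylindrical; auto. intros s t Hs Ht.
    assert (E := gauss_curvature_translation alpha beta s t (HN s t Hs Ht)).
    rewrite HK in E by assumption. lra.
  - intros Hp (c & Hc & HK).
    assert (E : forall s t, in_interval a1 b1 s -> in_interval a2 b2 t ->
      let N := vcross (vderive alpha s) (vderive beta t) in
      c * vdot N N ^ 2 = - (vdot (binormal alpha s) (vderive beta t)
                            * vdot (binormal beta t) (vderive alpha s))).
    { intros s t Hs Ht. rewrite <- (HK s t Hs Ht). now apply gauss_curvature_translation, HN. }
    destruct Hp as [Hp|Hp].
    + apply (planar_translation_curvature_absurd a1 b1 a2 b2 alpha beta c); auto.
    (* Exchanging the curves only changes the sign of [N], and the curvature equation is even in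
       [N]. *)
    + apply (planar_translation_curvature_absurd a2 b2 a1 b1 beta alpha c); auto.
      * intros t s Ht Hs Z. apply (HN s t Hs Ht). rewrite vcross_anticomm, Z.
        apply vec_eq; vunfold; ring.
      * intros t s Ht Hs. cbv zeta. rewrite Rmult_comm with (r1 := vdot (binormal beta t) _).
        rewrite <- (E s t Hs Ht). vunfold; ring.
Qed.
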